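(* Let $c$ be the content function given by $c(\mathrm{box}_i)=i-1$ for $1\le i\le n$. Let $t=(t_1,\dots,t_n)=(1,q^2,\dots,q^{2(n-1)})$ and let $\mathbb Cv_t$ be the one dimensional module for $\mathbb C[X]=\mathbb C[x_1^{\pm1},\dots,x_n^{\pm1}]\subseteq\tilde H_n$ given by $x_iv_t=t_iv_t$ for all $1\le i\le n$. Then in the Grothendieck ring of finite dimensional $\tilde H_n$-modules $$\big[\mathrm{Ind}_{\mathbb C[X]}^{\tilde H_n}(\mathbb Cv_t)\big]=\sum_{\lambda/\mu}\big[\tilde H^{(c,\lambda/\mu)}\big],$$ where the sum is over all connected ribbons $\lambda/\mu$ with $n$ boxes.
   Context: **Algebra.** Let $n\ge 1$ and let $q\in\mathbb C^*$ be not a root of unity. The affine Hecke algebra $\tilde H_n$ is the unital associative $\mathbb C$-algebra generated by $T_1,\dots,T_{n-1}$ and invertible elements $x_1,\dots,x_n$ with relations: $T_iT_j=T_jT_i$ if $|i-j|>1$; $T_iT_{i+1}T_i=T_{i+1}T_iT_{i+1}$ for $1\le i\le n-2$; $T_i^2=(q-q^{-1})T_i+1$; $x_ix_j=x_jx_i$; and for $\gamma\in\mathbb Z^n$, $x^\gamma=x_1^{\gamma_1}\cdots x_n^{\gamma_n}$, $$x^\gamma T_i=T_ix^{s_i\gamma}+(q-q^{-1})\frac{(x^\gamma-x^{s_i\gamma})x_{i+1}}{x_{i+1}-x_i},$$ where $s_i=(i,i+1)$ swaps coordinates $i,i+1$ of $\gamma$. $\mathrm{Ind}_{\mathbb C[X]}^{\tilde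 H_n}=\tilde H_n\otimes_{\mathbb C[X]}(-)$. **Skew shapes and ribbons.** Partitions are drawn with boxes pushed up and to the left; rows numbered top to bottom, columns left to right. For partitions $\mu\subseteq\lambda$, the skew shape $\lambda/\mu$ is the set of boxes of $\lambda$ not in $\mu$; skew shapes that are translates of one another are identified. A box in row $r$, column $s$ lies on the diagonal of index $s-r$. The $n$ boxes are numbered $\mathrm{box}_1,\dots,\mathrm{box}_n$ along diagonals from southwest to northeast (increasing index), and northwest to southeast within a diagonal. A ribbon is a skew shape which has at most one box in each diagonal; connected means connected via boxes sharing an edge. A standard tableau of shape $\lambda/\mu$ is a filling of the boxes with $1,\dots,n$ (each once) increasing left to right in rows and top to bottom in columns. **The module.** $\tilde H^{(c,\lambda/\mu)}$ is the $\tilde H_n$-module with $\mathbb C$-basis $\{v_L\}$, $L$ running over standard tableaux of shape $\lambda/\mu$, and action $$x_iv_L=q^{2c(L(i))}v_L,\qquad T_iv_L=(T_i)_{LL}v_L+(q^{-1}+(T_i)_{LL})v_{s_iL},\qquad (T_i)_{LL}=\frac{q-q^{-1}}{1-q^{2(c(L(i))-c(L(i+1)))}},$$ where $L(i)$ is the box of $L$ containing $i$, $s_iL$ is $L$ with the entries $i,i+1$ interchanged, and $v_{s_iL}=0$ if $s_iL$ is not standard. *)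

(* Defs.v *)
From HB Require Import structures.
From mathcomp Require Import all_boot all_order all_algebra.
From mathcomp Require Import fingroup perm generic_quotient ring_quotient.
From mathcomp Require Import boolp.
From mathcomp Require Import finmap monalg.
From mathcomp Require Import ring zify.

Set Implicit Arguments.
Unset Strict Implicit.
Unset Printing Implicit Defensive.

Import Order.TTheory GRing.Theory Num.Theory.
Import ring_quotient.Quotient.
Local Open Scope ring_scope.
Local Open Scope quotient_scope.

Section GeneratedSubgroup.
Variables (Z : zmodType) (S : Z -> Prop).

Definition gensub : {pred Z} := fun z =>
  `[< forall P : {pred Z}, zmod_closed P -> (forall s, S s -> s \in P) ->
      z \in P >].

Lemma gensub_gen s : S s -> s \in gensub.
Proof. by move=> Ss; apply/asboolP => P _; apply. Qed.

Lemma gensub_zmod : zmod_closed gensub.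
Proof.
split; first by apply/asboolP => P [].
move=> x y /asboolP Hx /asboolP Hy; apply/asboolP => P cP SP.
by apply: cP.2; [apply: Hx | apply: Hy].
Qed.

HB.instance Definition _ := GRing.isZmodClosed.Build Z gensub gensub_zmod.

Lemma gensub_min (P : {pred Z}) :
    zmod_closed P -> (forall s, S s -> s \in P) ->
  forall z, z \in gensub -> z \in P.
Proof. by move=> cP SP z /asboolP; apply. Qed.

Lemma gensub_stable (f : Z -> Z) : {morph f : x y / x - y} ->
    (forall s, S s -> f s \in gensub) ->
  forall z, z \in gensub -> f z \in gensub.
Proof.
move=> fB Sf; apply: (gensub_min (P := [pred z | f z \in gensub])) => //.
split; last by move=> x y; rewrite !inE fB; apply: rpredB.
by rewrite inE -[0]subr0 fB subrr rpred0.
Qed.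

End GeneratedSubgroup.

Lemma malg_scaleAr (C : comNzRingType) (K : monomType) (c : C)
    (x y : {malg C[K]}) :
  c *: (x * y) = x * (c *: y).
Proof.
have cx : x * c%:MP = c%:MP * x.
  rewrite [x]monalgE mulr_suml mulr_sumr; apply: eq_bigr => k _.
  by rewrite !malgM_def !fgmulUU mulrC mulm1 mul1m.
by rewrite -!mul_malgC !mulrA cx.
Qed.

(* The free algebra on G: {fmonom G} is the monoid of words over G.           *)
Definition freealg (C : fieldType) (G : choiceType) := {malg C[{fmonom G}]}.

HB.instance Definition _ (C : fieldType) (G : choiceType) :=
  GRing.Lalgebra.on (freealg C G).
HB.instance Definition _ (C : fieldType) (G : choiceType) :=
  GRing.Lalgebra_isAlgebra.Build C (freealg C G)
    (@malg_scaleAr C {fmonom G}).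

(* The quotient of F by the two-sided ideal generated by the u - w, for       *)
(* rel u w; it may be trivial, so that only a pzRingType is obtained here.    *)
Section QuotientAlgebra.
Variables (C : fieldType) (F : algType C).
Variable rel : F -> F -> Prop.

Definition two_sided_span (s : F) :=
  exists a u w b, rel u w /\ s = a * (u - w) * b.

Local Notation I := (gensub two_sided_span).

Definition quotalg := {quot I}.

HB.instance Definition _ := GRing.Zmodule.on quotalg.
HB.instance Definition _ := EqQuotient.on quotalg.

Lemma pidealMl a z : z \in I -> a * z \in I.
Proof.
apply: (gensub_stable (f := *%R a)) => [x y|s]; first by rewrite mulrBr.
move=> [c [u [w [b [uw ->]]]]]; rewrite !mulrA; apply: gensub_gen.
by exists (a * c), u, w, b.
Qed.

Lemma pidealMr a z : z \in I -> z * a \in I.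
Proof.
apply: (gensub_stable (f := *%R^~ a)) => [x y|s]; first by rewrite mulrBl.
move=> [c [u [w [b [uw ->]]]]]; rewrite -!mulrA; apply: gensub_gen.
by exists c, u, w, (b * a); rewrite -!mulrA.
Qed.

Definition quotalg_one : quotalg := lift_cst quotalg 1.
Definition quotalg_mul := lift_op2 quotalg *%R.
Definition quotalg_scale (c : C) := lift_op1 quotalg ( *:%R c).

Canonical pi_quotalg_one := PiConst quotalg_one.

Lemma pi_mul_quotalg :
  {morph \pi_quotalg : x y / x * y >-> quotalg_mul x y}.
Proof.
move=> x y; unlock quotalg_mul; apply/eqP; rewrite piE equivE.
rewrite -[x * y](subrK (x * generic_quotient.repr (\pi_quotalg y))) -mulrBr -addrA -mulrBl.
rewrite rpredD //.
  by rewrite pidealMl // idealrBE reprK.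
by rewrite pidealMr // idealrBE reprK.
Qed.
Canonical pi_quotalg_mul := PiMorph2 pi_mul_quotalg.

Lemma pi_scale_quotalg c :
  {morph \pi_quotalg : x / c *: x >-> quotalg_scale c x}.
Proof.
move=> x; unlock quotalg_scale; apply/eqP; rewrite piE equivE.
by rewrite -scalerBr -mulr_algl pidealMl // idealrBE reprK.
Qed.
Canonical pi_quotalg_scale c := PiMorph1 (pi_scale_quotalg c).

Lemma quotalg_mulA : associative quotalg_mul.
Proof. by elim/quotW=> x; elim/quotW=> y; elim/quotW=> z; rewrite !piE mulrA. Qed.
Lemma quotalg_mul1 : left_id quotalg_one quotalg_mul.
Proof. by elim/quotW=> x; rewrite !piE mul1r. Qed.
Lemma quotalg_1mul : right_id quotalg_one quotalg_mul.
Proof. by elim/quotW=> x; rewrite !piE mulr1. Qed.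
Lemma quotalg_mulDl : left_distributive quotalg_mul +%R.
Proof. by elim/quotW=> x; elim/quotW=> y; elim/quotW=> z; rewrite !piE mulrDl. Qed.
Lemma quotalg_mulDr : right_distributive quotalg_mul +%R.
Proof. by elim/quotW=> x; elim/quotW=> y; elim/quotW=> z; rewrite !piE mulrDr. Qed.

HB.instance Definition _ := GRing.Zmodule_isPzRing.Build quotalg
  quotalg_mulA quotalg_mul1 quotalg_1mul quotalg_mulDl quotalg_mulDr.

Lemma quotalg_scaleA c d x :
  quotalg_scale c (quotalg_scale d x) = quotalg_scale (c * d) x.
Proof. by elim/quotW: x => x; rewrite !piE scalerA. Qed.
Lemma quotalg_scale1 : left_id 1 quotalg_scale.
Proof. by elim/quotW=> x; rewrite !piE scale1r. Qed.
Lemma quotalg_scaleDr : right_distributive quotalg_scale +%R.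
Proof. by move=> c; elim/quotW=> x; elim/quotW=> y; rewrite !piE scalerDr. Qed.
Lemma quotalg_scaleDl x : {morph quotalg_scale^~ x : c d / c + d}.
Proof. by move=> c d; elim/quotW: x => x; rewrite !piE scalerDl. Qed.

HB.instance Definition _ := GRing.Zmodule_isLmodule.Build C quotalg
  quotalg_scaleA quotalg_scale1 quotalg_scaleDr quotalg_scaleDl.

Lemma quotalg_scaleAl c (x y : quotalg) : c *: (x * y) = (c *: x) * y.
Proof.
elim/quotW: x => x; elim/quotW: y => y.
rewrite /GRing.scale /GRing.mul /=.
by rewrite !piE scalerAl.
Qed.
Lemma quotalg_scaleAr c (x y : quotalg) : c *: (x * y) = x * (c *: y).
Proof.
elim/quotW: x => x; elim/quotW: y => y.
rewrite /GRing.scale /GRing.mul /=.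
by rewrite !piE scalerAr.
Qed.

End QuotientAlgebra.

(* Indices are 0-based: lo i and hi i are the positions i and i+1 in 'I_n.    *)
Section Simple.
Variable n : nat.
Implicit Types (i : 'I_n.-1) (g : {ffun 'I_n -> int}).

Lemma lo_subproof i : (i < n)%N.
Proof. exact: leq_trans (ltn_ord i) (leq_pred n). Qed.
Lemma hi_subproof i : (i.+1 < n)%N.
Proof. by have := ltn_ord i; rewrite ltn_predRL. Qed.

Definition lo i : 'I_n := Ordinal (lo_subproof i).
Definition hi i : 'I_n := Ordinal (hi_subproof i).
Definition simple i : {perm 'I_n} := tperm (lo i) (hi i).
Definition swap (T : Type) i (f : {ffun 'I_n -> T}) : {ffun 'I_n -> T} :=
  [ffun j => f (simple i j)].

Lemma lo_neq_hi i : lo i != hi i.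
Proof. by rewrite -val_eqE /= neq_ltn ltnSn. Qed.

End Simple.

Section Monomials.
Variables (n : nat) (A : pzRingType) (x xV : 'I_n -> A).
Implicit Types (i : 'I_n.-1) (j : 'I_n) (g : {ffun 'I_n -> int}).

Definition xpow j (k : int) : A :=
  match k with Posz m => x j ^+ m | Negz m => xV j ^+ m.+1 end.

Definition xmon g : A := \prod_(j < n) xpow j (g j).

(* The Laurent polynomial (x^g - x^(s_i g)) x_(i+1) / (x_(i+1) - x_i): if     *)
(* a = g_i <= b = g_(i+1), it is the sum of the monomials obtained from x^g   *)
(* by replacing x_i^a x_(i+1)^b with x_i^(b-1-k) x_(i+1)^(a+1+k), 0 <= k < b-a;*)
(* if a > b, it is the opposite of the expression for s_i g. See bernsteinE.  *)
Definition bernstein_pos i g : A :=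
  \sum_(k < `|g (hi i) - g (lo i)|)
    xmon [ffun j => if j == lo i then g (hi i) - 1 - k%:Z
                    else if j == hi i then g (lo i) + 1 + k%:Z else g j].

Definition bernstein i g : A :=
  if g (lo i) <= g (hi i) then bernstein_pos i g
  else - bernstein_pos i (swap i g).

End Monomials.

Section HeckeRelations.
Variables (C : fieldType) (n : nat) (A : lalgType C).
Variables (T : 'I_n.-1 -> A) (x xV : 'I_n -> A).
Implicit Types (i : 'I_n.-1) (j : 'I_n) (g : {ffun 'I_n -> int}).

Inductive hecke_rel (q : C) : A -> A -> Prop :=
| hecke_xxV j : hecke_rel q (x j * xV j) 1
| hecke_xVx j : hecke_rel q (xV j * x j) 1
| hecke_xx j k : hecke_rel q (x j * x k) (x k * x j)
| hecke_TT (i k : 'I_n.-1) : (i.+1 < k)%N || (k.+1 < i)%N ->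
    hecke_rel q (T i * T k) (T k * T i)
| hecke_braid (i k : 'I_n.-1) : k = i.+1 :> nat ->
    hecke_rel q (T i * T k * T i) (T k * T i * T k)
| hecke_quad i : hecke_rel q (T i ^+ 2) ((q - q^-1) *: T i + 1)
| hecke_bernstein i g :
    hecke_rel q (xmon x xV g * T i)
                (T i * xmon x xV (swap i g) + (q - q^-1) *: bernstein x xV i g).

End HeckeRelations.

Section Bernstein.
Variables (C : fieldType) (n : nat).
Implicit Types (i : 'I_n.-1) (g : {ffun 'I_n -> int}).

Lemma xmon_field (x : 'I_n -> C) g :
  xmon x (fun j => (x j)^-1) g = \prod_j x j ^ g j.
Proof.
apply: eq_bigr => j _; case: (g j) => m //=.
by rewrite exprVn.
Qed.

Lemma bernsteinE (x : 'I_n -> C) i g : (forall j, x j != 0) ->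
  let y j := (x j)^-1 in
  bernstein x y i g * (x (hi i) - x (lo i)) =
  (xmon x y g - xmon x y (swap i g)) * x (hi i).
Proof.
move=> xn0 y.
pose r (h : {ffun 'I_n -> int}) :=
  \prod_(j | (j != lo i) && (j != hi i)) x j ^ h j.
have monE h : xmon x y h =
    x (lo i) ^ h (lo i) * x (hi i) ^ h (hi i) * r h.
  rewrite xmon_field (bigD1 (lo i)) //= (bigD1 (hi i)) //=.
    by rewrite mulrA.
  by rewrite eq_sym lo_neq_hi.
have hiNlo : (hi i == lo i) = false by rewrite eq_sym; apply/negbTE/lo_neq_hi.
have swE h : xmon x y (swap i h) =
    x (lo i) ^ h (hi i) * x (hi i) ^ h (lo i) * r h.
  rewrite monE !ffunE tpermL tpermR; congr (_ * _).
  apply: eq_bigr => j /andP[j1 j2]; rewrite ffunE tpermD // eq_sym //.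
have pos (h : {ffun 'I_n -> int}) : h (lo i) <= h (hi i) ->
    bernstein_pos x y i h * (x (hi i) - x (lo i)) =
    (xmon x y h - xmon x y (swap i h)) * x (hi i).
  move=> le_h; rewrite /bernstein_pos swE monE.
  set a := h (lo i); set b := h (hi i); set d := `|b - a|%N.
  have ebd : b = a + d%:Z.
    by rewrite /d; move: le_h; rewrite -/a -/b; lia.
  set u := x (lo i); set w := x (hi i).
  have un0 : u != 0 by apply: xn0.
  have wn0 : w != 0 by apply: xn0.
  have -> : u ^ a * w ^ b * r h - u ^ b * w ^ a * r h =
      u ^ a * w ^ a * r h * (w ^+ d - u ^+ d).
    by rewrite ebd !expfzDr // -!exprnP; ring.
  rewrite -[w ^+ d - _]opprB subrXX.
  have -> : \sum_(k < d)
      xmon x y [ffun j => if j == lo i then b - 1 - k%:Z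
        else if j == hi i then a + 1 + k%:Z else h j] =
      u ^ a * w ^ a * r h * w * \sum_(k < d) u ^+ (d.-1 - k) * w ^+ k.
    rewrite mulr_sumr; apply: eq_bigr => k _.
    rewrite monE !ffunE eqxx hiNlo eqxx.
    have -> : r [ffun j => if j == lo i then b - 1 - k%:Z
        else if j == hi i then a + 1 + k%:Z else h j] = r h.
      by apply: eq_bigr => j /andP[/negbTE j1 /negbTE j2]; rewrite ffunE j1 j2.
    have -> : b - 1 - k%:Z = a + (d.-1 - k)%N%:Z.
      by rewrite ebd; have := ltn_ord k; lia.
    rewrite -/u -/w !expfzDr // expr1z -!exprnP; ring.
  by rewrite -/a -/b; ring.
rewrite /bernstein; case: ifPn => [/pos //|]; rewrite -ltNge => lt_g.
rewrite mulNr pos; last by rewrite !ffunE tpermL tpermR ltW.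
rewrite -mulNr opprB; congr ((_ - _) * _).
rewrite swE monE !ffunE tpermL tpermR; congr (_ * _).
by apply: eq_bigr => j /andP[j1 j2]; rewrite ffunE tpermD // eq_sym.
Qed.
End Bernstein.

(* T_i |-> q, x_j |-> q^(2j) is compatible with the relations, so that the    *)
(* affine Hecke algebra is not the zero ring.                                 *)
Section HeckeCharacter.
Variables (C : fieldType) (n : nat) (q : C).

Definition char_base : C := if q == 0 then 1 else q.
Local Notation p := char_base.

Lemma char_base_neq0 : p != 0.
Proof. by rewrite /char_base; case: (eqVneq q 0) => [_|//]; rewrite oner_neq0. Qed.

Lemma char_baseV : q - q^-1 = p - p^-1.
Proof.
rewrite /char_base; case: (eqVneq q 0) => [->|//].
by rewrite invr0 invr1 !subrr.
Qed.

Variables (F : lalgType C) (T : 'I_n.-1 -> F) (x xV : 'I_n -> F).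
Variable ev : {rmorphism F -> C}.
Local Notation c := (fun j : 'I_n => p ^+ (2 * j)).
Local Notation cV := (fun j : 'I_n => (p ^+ (2 * j))^-1).
Hypothesis evZ : forall a z, ev (a *: z) = a * ev z.
Hypothesis evT : forall i, ev (T i) = p.
Hypothesis evx : forall j, ev (x j) = c j.
Hypothesis evxV : forall j, ev (xV j) = cV j.

Lemma hecke_char u w : hecke_rel T x xV q u w -> ev u = ev w.
Proof.
have pn0 := char_base_neq0; have pV := char_baseV.
have key (r d b m m' : C) : r != 0 -> d != 0 ->
    b * (r ^+ 2 * d - d) = (m - m') * (r ^+ 2 * d) ->
    m * r = r * m' + (r - r^-1) * b.
  move=> r0 d0 E; apply: (mulfI d0); apply: (mulfI r0).
  have -> : r * (d * (r * m' + (r - r^-1) * b)) =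
      r * d * r * m' + b * (r ^+ 2 * d - d) by field.
  by rewrite E; ring.
have cn0 j : c j != 0 by rewrite expf_neq0.
have evmon g : ev (xmon x xV g) = xmon c cV g.
  rewrite rmorph_prod; apply: eq_bigr => j _.
  by case: (g j) => m /=; rewrite rmorphXn /= ?evx ?evxV.
have evpos i g : ev (bernstein_pos x xV i g) = bernstein_pos c cV i g.
  by rewrite rmorph_sum; apply: eq_bigr => k _; rewrite evmon.
have evber i g : ev (bernstein x xV i g) = bernstein c cV i g.
  by rewrite /bernstein; case: ifP => _; rewrite ?rmorphN evpos.
case=> [j|j|j k|i k _|i k _|i|i g].
- by rewrite rmorphM rmorph1 evx evxV mulfV.
- by rewrite rmorphM rmorph1 evx evxV mulVf.
- by rewrite !rmorphM mulrC.
- by rewrite !rmorphM mulrC.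
- by rewrite !rmorphM !evT.
- by rewrite rmorphXn rmorphD rmorph1 /= evZ evT pV; field.
- rewrite rmorphD !rmorphM /= evZ evT !evmon evber pV.
  have := bernsteinE i g cn0.
  have -> : c (hi i) = p ^+ 2 * c (lo i) by rewrite /= mulnS exprD.
  by apply: key => //; apply: cn0.
Qed.

End HeckeCharacter.

Section AffineHecke.
Variables (C : fieldType) (n : nat) (q : C).

(* The letters of the generators T_i, x_j and the inverse of x_j are inl i,   *)
(* inr (j, true) and inr (j, false).                                          *)
Definition hletter : choiceType := ('I_n.-1 + 'I_n * bool)%type.
Local Notation F := (freealg C hletter).

Definition letter (a : hletter) : F := << fmu a >> : {malg C[{fmonom hletter}]}.

Definition affhecke_rel : F -> F -> Prop :=
  hecke_rel (fun i => letter (inl i)) (fun j => letter (inr (j, true)))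
            (fun j => letter (inr (j, false))) q.

Definition affhecke := quotalg affhecke_rel.

HB.instance Definition _ := GRing.PzRing.on affhecke.
HB.instance Definition _ := GRing.Lmodule.on affhecke.

Section Nontrivial.
Local Notation p := (char_base q).

Let chi (a : hletter) : C :=
  match a with
  | inl _ => p
  | inr (j, true) => p ^+ (2 * j)
  | inr (j, false) => (p ^+ (2 * j))^-1
  end.

Let chim (m : {fmonom hletter}) : C := \prod_(a <- (m : seq hletter)) chi a.

Let chim_is_mmorphism : mmorphism chim.
Proof.
split; last by rewrite /chim fm1 big_nil.
by move=> m1 m2; rewrite /chim /mmul /= fmmulE big_cat.
Qed.
HB.instance Definition _ := isMultiplicative.Build _ _ chim chim_is_mmorphism.

Let ev : {rmorphism F -> C} := mmap idfun chim.
Let evZ c z : ev (c *: z) = c * ev z.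
Proof. exact: (@mmapZ _ _ _ idfun chim). Qed.
Let evl a : ev (letter a) = chi a.
Proof. by rewrite /ev /= mmapU /= mul1r /chim fmuE big_seq1. Qed.

Lemma affhecke1_neq0 : (1 : affhecke) != 0.
Proof.
have evrel u w : affhecke_rel u w -> ev u = ev w.
  by apply: hecke_char => // [i|j|j]; rewrite evl.
rewrite /GRing.one /=; apply/negP => /eqP.
rewrite /GRing.zero /= => /eqP; rewrite piE equivE subr0 => one_in.
have : ev 1 = 0.
  apply/eqP; apply: (gensub_min (P := [pred z | ev z == 0])) one_in.
    split; first by rewrite inE rmorph0.
    by move=> x y; rewrite !inE rmorphB => /eqP -> /eqP ->; rewrite subrr.
  move=> s [a [u [w [b [/evrel uw ->]]]]].
  by rewrite inE !rmorphM rmorphB uw subrr mulr0 mul0r.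
by rewrite rmorph1 => /eqP; rewrite oner_eq0.
Qed.

End Nontrivial.

HB.instance Definition _ :=
  GRing.PzSemiRing_isNonZero.Build affhecke affhecke1_neq0.
HB.instance Definition _ :=
  GRing.Lmodule_isLalgebra.Build C affhecke (@quotalg_scaleAl _ _ _).
HB.instance Definition _ :=
  GRing.Lalgebra_isAlgebra.Build C affhecke (@quotalg_scaleAr _ _ _).

Definition hT (i : 'I_n.-1) : affhecke := \pi_affhecke (letter (inl i)).
Definition hx (j : 'I_n) : affhecke := \pi_affhecke (letter (inr (j, true))).
Definition hxV (j : 'I_n) : affhecke := \pi_affhecke (letter (inr (j, false))).

(* C[X], as the subalgebra of affhecke generated by the x_j and their         *)
(* inverses.                                                                  *)
Definition laurent_pred : {pred affhecke} := fun h =>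
  `[< forall S : {pred affhecke}, GRing.subalg_closed S ->
      (forall j, hx j \in S) -> (forall j, hxV j \in S) -> h \in S >].

Lemma laurent_subalg : GRing.subalg_closed laurent_pred.
Proof.
split=> [|c u w /asboolP Hu /asboolP Hw|u w /asboolP Hu /asboolP Hw];
  apply/asboolP => S cS Sx SxV; first by case: cS.
- by case: cS (cS) => _ cS _ ?; apply: cS; [apply: Hu | apply: Hw].
- by case: cS (cS) => _ _ cS ?; apply: cS; [apply: Hu | apply: Hw].
Qed.

HB.instance Definition _ :=
  GRing.isSubalgClosed.Build C affhecke laurent_pred laurent_subalg.

Record laurent := Laurent {
  laurent_val : affhecke;
  laurent_valP : laurent_val \in laurent_pred
}.

HB.instance Definition _ := [isSub for laurent_val].
HB.instance Definition _ := [Choice of laurent by <:].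
HB.instance Definition _ := [SubChoice_isSubLalgebra of laurent by <:].

Lemma hx_laurent j : hx j \in laurent_pred.
Proof. by apply/asboolP => S _ Sx _. Qed.

Definition lx (j : 'I_n) : laurent := Laurent (hx_laurent j).

End AffineHecke.

Lemma subACA (Z : zmodType) (a a' b b' c c' : Z) :
  a - a' - (b - b') - (c - c') = a - b - c - (a' - b' - c').
Proof. by rewrite !opprD !opprK [a - a' + _]addrACA [LHS]addrACA. Qed.

(* H (x)_A N for a left A-module N, H being a right A-module through f: the   *)
(* free abelian group on H * N modulo biadditivity and A-balancedness.        *)
Section ExtensionOfScalars.
Variables (A H : pzRingType) (f : {rmorphism A -> H}) (N : lmodType A).
Local Notation K := (H * N)%type.
Local Notation Z := {malg int[K]}.

Inductive tensor_rel : Z -> Prop :=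
| tensor_Dl h h' v :
    tensor_rel (<< (h + h', v) >> - << (h, v) >> - << (h', v) >>)
| tensor_Dr h v v' :
    tensor_rel (<< (h, v + v') >> - << (h, v) >> - << (h, v') >>)
| tensor_bal h a v :
    tensor_rel (<< (h * f a, v) >> - << (h, a *: v) >>).

Local Notation I := (gensub tensor_rel).

Definition tensor := {quot I}.

HB.instance Definition _ := GRing.Zmodule.on tensor.
HB.instance Definition _ := EqQuotient.on tensor.

Definition tensor_act (h : H) (z : Z) : Z :=
  \sum_(k <- msupp z) << z@_k *g (h * k.1, k.2) >>.

Lemma tensor_actB h : {morph tensor_act h : x y / x - y}.
Proof.
move=> x y; pose D := (msupp x `|` msupp y)%fset.
have E z : (msupp z `<=` D)%fset -> tensor_act h z =
    \sum_(k <- D) << z@_k *g (h * k.1, k.2) >>.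
  move=> sD; apply: big_fset_incl => // k _ /mcoeff_outdom ->.
  by rewrite monalgU0.
rewrite !E ?fsubsetUl ?fsubsetUr ?msuppB_le // -sumrB.
by apply: eq_bigr => k _; rewrite mcoeffB monalgUB.
Qed.

Lemma tensor_act0 h : tensor_act h 0 = 0.
Proof. by rewrite -[0 in LHS]subr0 tensor_actB subrr. Qed.

Lemma tensor_actD h : {morph tensor_act h : x y / x + y}.
Proof.
by move=> x y; rewrite -[y in LHS]opprK -[- y]sub0r !tensor_actB tensor_act0
  sub0r opprK.
Qed.

Lemma tensor_actU h c k :
  tensor_act h << c *g k >> = << c *g (h * k.1, k.2) >>.
Proof.
rewrite /tensor_act msuppU; case: eqVneq => [->|_].
  by rewrite big_seq_fset0 monalgU0.
by rewrite big_seq_fset1 mcoeffUU.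
Qed.

Lemma tensor_ind (P : Z -> Prop) : P 0 ->
    (forall x y, P x -> P y -> P (x - y)) -> (forall k, P << k >>) ->
  forall z, P z.
Proof.
move=> P0 PB PU z.
have PN x : P x -> P (- x) by move=> Px; rewrite -sub0r; apply: PB.
have PD x y : P x -> P y -> P (x + y).
  by move=> Px Py; rewrite -[y]opprK; apply/PB/PN.
rewrite [z]monalgE; apply: (big_ind P) => // k _.
have Pn m : P << m%:Z *g k >>.
  elim: m => [|m IHm]; first by rewrite monalgU0.
  by rewrite -addn1 PoszD monalgUD; apply: PD.
by case: (z@_k) => m; rewrite ?NegzE ?monalgUN; [apply: Pn | apply/PN/Pn].
Qed.

Lemma tensor_act_stable h z : z \in I -> tensor_act h z \in I.
Proof.
apply: (gensub_stable (@tensor_actB h)) => s sP; apply: gensub_gen.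
case: sP => [g g' v|g v v'|g a v]; rewrite !tensor_actB !tensor_actU /=.
- by rewrite mulrDr; apply: tensor_Dl.
- exact: tensor_Dr.
- by rewrite mulrA; apply: tensor_bal.
Qed.

Definition tensor_scale h := lift_op1 tensor (tensor_act h).

Lemma pi_scale_tensor h :
  {morph \pi_tensor : x / tensor_act h x >-> tensor_scale h x}.
Proof.
move=> x; unlock tensor_scale; apply/eqP; rewrite piE equivE.
by rewrite -tensor_actB tensor_act_stable // idealrBE reprK.
Qed.
Canonical pi_tensor_scale h := PiMorph1 (pi_scale_tensor h).

Lemma tensor_scaleA g h x :
  tensor_scale g (tensor_scale h x) = tensor_scale (g * h) x.
Proof.
elim/quotW: x => x; rewrite !piE; apply/eqmodP => /=.
rewrite equivE; suff -> : tensor_act g (tensor_act h x) = tensor_act (g * h) x.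
  by rewrite subrr rpred0.
elim/tensor_ind: x => [|x y|k]; first by rewrite !tensor_act0.
  by rewrite !tensor_actB => -> ->.
by rewrite !tensor_actU /= mulrA.
Qed.

Lemma tensor_scale1 : left_id 1 tensor_scale.
Proof.
elim/quotW=> x; rewrite !piE; congr (\pi_tensor _).
elim/tensor_ind: x => [|x y|[h v]]; first by rewrite !tensor_act0.
  by rewrite !tensor_actB => -> ->.
by rewrite !tensor_actU /= mul1r.
Qed.

Lemma tensor_scaleDr : right_distributive tensor_scale +%R.
Proof.
by move=> h; elim/quotW=> x; elim/quotW=> y; rewrite !piE tensor_actD.
Qed.

Lemma tensor_scaleDl x : {morph tensor_scale^~ x : g h / g + h}.
Proof.
move=> g h; elim/quotW: x => x; rewrite !piE; apply/eqmodP => /=.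
rewrite equivE opprD addrA.
pose d z := tensor_act (g + h) z - tensor_act g z - tensor_act h z.
have dB : {morph d : y z / y - z}.
  by move=> y z; rewrite /d !tensor_actB; apply: subACA.
have dU k : d << k >> \in I.
  case: k => k v; rewrite /d !tensor_actU /= mulrDl.
  exact/gensub_gen/tensor_Dl.
rewrite -/(d x); move: d dB dU => d dB dU.
elim/tensor_ind: x => [|x y Ix Iy|k]; last exact: dU.
  by rewrite -[0]subr0 dB subrr rpred0.
by rewrite dB; apply: (gensub_zmod tensor_rel).2.
Qed.

HB.instance Definition _ := GRing.Zmodule_isLmodule.Build H tensor
  tensor_scaleA tensor_scale1 tensor_scaleDr tensor_scaleDl.

End ExtensionOfScalars.

(* Finite dimensional modules over a C-algebra H, as matrix representations   *)
(* acting on column vectors; every finite dimensional module is isomorphic    *)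
(* to one of these.                                                           *)
Section FinDimModules.
Variables (C : fieldType) (H : algType C).

Record fdmod := FDMod {
  fddim : nat;
  fdact : {lrmorphism H -> 'M[C]_fddim}
}.

HB.instance Definition _ := gen_eqMixin fdmod.
HB.instance Definition _ := gen_choiceMixin fdmod.

Definition fdmor (V W : fdmod) (f : {linear 'cV[C]_(fddim V) -> 'cV[C]_(fddim W)}) :=
  forall h u, f (fdact V h *m u) = fdact W h *m f u.

Definition short_exact (V' V V'' : fdmod) :=
  exists (f : {linear 'cV[C]_(fddim V') -> 'cV[C]_(fddim V)})
         (g : {linear 'cV[C]_(fddim V) -> 'cV[C]_(fddim V'')}),
    [/\ fdmor f, fdmor g, injective f, forall w, exists u, g u = w
      & forall u, g u = 0 <-> exists u', f u' = u].

Local Notation Z := {malg int[fdmod]}.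

Definition groth_rel (z : Z) :=
  exists V' V V'', short_exact V' V V'' /\ z = << V >> - << V' >> - << V'' >>.

Definition groth := {quot (gensub groth_rel)}.

HB.instance Definition _ := GRing.Zmodule.on groth.
HB.instance Definition _ := EqQuotient.on groth.

Definition fdclass (V : fdmod) : groth := \pi_groth (<< V >> : Z).

Definition fdmod_iso (V : fdmod) (M : lmodType H) :=
  exists f : 'cV[C]_(fddim V) -> M,
    [/\ bijective f, {morph f : u v / u + v}
      & forall h u, f (fdact V h *m u) = h *: f u].

End FinDimModules.

(* Boxes (r, s) in row r and column s (from 0); a skew shape is a set of      *)
(* boxes. A connected skew shape with n boxes has a unique translate with     *)
(* boxes in row 0 and in column 0; it lies in 'I_n * 'I_n, and we use it to   *)
(* represent the translation class.                                           *)
Section Shapes.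
Variable n : nat.
Local Notation box := ('I_n * 'I_n)%type.
Implicit Types (B : {set box}) (b : box).

Definition is_partition (la : seq nat) := sorted geq la.

Definition is_skew B : Prop := exists la mu : seq nat,
  [/\ is_partition la, is_partition mu,
      forall r, (nth 0 mu r <= nth 0 la r)%N
    & forall r s : nat, (nth 0 mu r <= s < nth 0 la r)%N <->
        exists2 b, b \in B & (r, s) = (val b.1, val b.2)].

Definition diag b : int := b.2%:Z - b.1%:Z.

Definition is_ribbon B := [forall b in B, forall b' in B,
  (diag b == diag b') ==> (b == b')].

Definition adjacent b b' :=
  ((b.1 == b'.1) && ((b.2.+1 == b'.2 :> nat) || (b'.2.+1 == b.2 :> nat))) ||
  ((b.2 == b'.2) && ((b.1.+1 == b'.1 :> nat) || (b'.1.+1 == b.1 :> nat))).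

Definition is_connected B := [forall b in B, forall b' in B,
  connect [rel u v | [&& u \in B, v \in B & adjacent u v]] b b'].

Definition normalized B :=
  [exists b in B, val b.1 == 0%N] && [exists b in B, val b.2 == 0%N].

Definition connected_ribbons : {set {set box}} :=
  [set B | [&& `[< is_skew B >], is_ribbon B, is_connected B, normalized B
             & #|B| == n]].

(* Numbering of the boxes along diagonals, from southwest to northeast, and   *)
(* from northwest to southeast in a diagonal: box_i is the box of B preceded  *)
(* by i - 1 others, so that ribbon_content is c(box_i) = i - 1.               *)
Definition box_before b' b :=
  (diag b' < diag b) || ((diag b' == diag b) && (b'.1 < b.1)%N).

Definition ribbon_content B b : int := #|[set b' in B | box_before b' b]|%:Z.

(* A filling of B is given by the map L sending i to the box containing i.    *)
Definition filling := {ffun 'I_n -> box}.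

Definition standard_tableaux B : {set filling} :=
  [set L : filling | [&& injectiveb L, [set L i | i : 'I_n] == B,
     [forall i, forall j, ((L i).1 == (L j).1) && ((L i).2 < (L j).2)%N ==> (i < j)%N]
   & [forall i, forall j, ((L i).2 == (L j).2) && ((L i).1 < (L j).1)%N ==> (i < j)%N]]].

End Shapes.

(* W is the module H^(c, B): it has a basis v_L, L standard of shape B, with  *)
(* the prescribed action of x_j and T_i; v_L = 0 if L is not standard.        *)
Section TableauModule.
Variables (C : fieldType) (n : nat) (q : C).
Local Notation H := (affhecke n q).

Definition T_diag (c : 'I_n * 'I_n -> int) (L : filling n) (i : 'I_n.-1) : C :=
  (q - q^-1) / (1 - q ^ (2 * (c (L (lo i)) - c (L (hi i))))).

Definition is_tableau_module (c : 'I_n * 'I_n -> int) (B : {set 'I_n * 'I_n})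
    (W : fdmod H) : Prop :=
  exists v : filling n -> 'cV[C]_(fddim W),
    [/\ basis_of fullv [seq v L | L in standard_tableaux B],
        forall L, L \notin standard_tableaux B -> v L = 0,
        forall L j, L \in standard_tableaux B ->
          fdact W (hx q j) *m v L = q ^ (2 * c (L j)) *: v L
      & forall L i, L \in standard_tableaux B ->
          fdact W (hT q i) *m v L =
            T_diag c L i *: v L + (q^-1 + T_diag c L i) *: v (swap i L)].

End TableauModule.

Section Induction.
Variables (C : fieldType) (n : nat) (q : C).

Definition laurent_incl : {rmorphism laurent n q -> affhecke n q} :=
  GRing.RMorphism.clone _ _ (\val : laurent n q -> affhecke n q) _.

Definition Ind (N : lmodType (laurent n q)) : lmodType (affhecke n q) :=
  tensor laurent_incl N.

Definition is_weight_line (t : 'I_n -> C) (N : lmodType (laurent n q)) (v : N) :=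
  [/\ v != 0, forall w : N, exists a : C, w = a%:A *: v
    & forall j, lx q j *: v = (t j)%:A *: v].

End Induction.

(* Main.v *)
(* The weights t_j = q^(2(j-1)) are pairwise distinct, so Young's seminormal   *)
(* formulas make sense on a basis (e_s) indexed by all permutations s, where  *)
(* x_j acts on e_s by q^(2 s(j)); they define a module V of dimension n!.     *)
(* The coefficient of e_(s o s_i) in T_i e_s vanishes only if                 *)
(* s(i) = s(i+1) + 1. Hence every e_s is reached from e_1, which has weight t,*)
(* by length-increasing steps, and V is a quotient of Ind. Conversely Ind is  *)
(* spanned by the n! vectors T_w (x) v_t, with T_w in normal form, so that V  *)
(* is isomorphic to Ind, with no appeal to the PBW theorem. The same vanishing*)
(* condition shows that the action can only enlarge the set of k such that    *)
(* k+1 stands before k in s, so V is filtered by these descent sets. A        *)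
(* connected ribbon is a lattice path, given by the set A of its vertical     *)
(* steps, its standard tableaux are the s with descent set A, and the layer   *)
(* of the filtration with label A is its tableau module.                      *)

Require Import Defs.
From HB Require Import structures.
From mathcomp Require Import reals complex.
From mathcomp Require Import all_boot all_order all_algebra.
From mathcomp Require Import fingroup perm generic_quotient ring_quotient.
From mathcomp Require Import boolp finmap monalg ring zify.

Set Implicit Arguments.
Unset Strict Implicit.
Unset Printing Implicit Defensive.

Import Order.TTheory GRing.Theory Num.Theory.
Import ring_quotient.Quotient.
Local Open Scope ring_scope.
Local Open Scope quotient_scope.

(** * Presentation of the affine Hecke algebra *)

(** Since q is not a root of unity, the weights q^(2 s(j)) of a permutation s are pairwise distinct.
    Young's seminormal formulas therefore have nonzero denominators. They satisfy the Hecke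
    relations coordinate by coordinate ([seminormal_rel]), and by the universal property
    ([affhecke_lift]) they define a module V with basis (e_s), of dimension n!.

    V is the induced module because of two bounds. From above: the Bernstein relation pushes
    monomials in the x_j through the T_i until they act on v_t by scalars, and products of the T_i
    reduce to n! normal forms, so Ind is spanned by n! vectors ([weight_vector_span]). From below:
    e_1 has weight t and generates V ([sn_cyclic]), so Frobenius reciprocity ([Ind_map_exists]) maps
    Ind onto V. A map onto a space of dimension n! from one spanned by n! vectors is bijective
    ([Ind_iso]).

    To decompose V, observe that exchanging the values at i and i+1 alters the relative order of two
    consecutive values only when s(i) and s(i+1) differ by one, and that the coefficient of T_i
    vanishes exactly when s(i) = s(i+1) + 1 ([sn_off_eq0]). The surviving moves can only create
    descents of the inverse of s, so the action is block triangular for inclusion of descent sets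
    ([sn_triangular]), and the class of V is the sum of the classes of its diagonal blocks, one for
    each subset A of the n-1 possible descents ([fdclass_labels]).

    Finally, connected ribbons with n boxes correspond to the sets A of vertical steps of a lattice
    path ([ribbon_in], [connected_ribbonP], [set_ribbon_inj]). A filling is standard exactly when
    its descent set is A ([standard_ribbonP]), since it is enough to compare consecutive boxes of
    the path. Hence block A is the tableau module of its ribbon ([sn_piece_tableau]). *)

Section HeckeRelMorphism.
Variables (C : fieldType) (n : nat) (A B : lalgType C).
Variable f : {lrmorphism A -> B}.
Variables (T : 'I_n.-1 -> A) (x xV : 'I_n -> A).

Lemma rmorph_xmon g : f (xmon x xV g) = xmon (f \o x) (f \o xV) g.
Proof.
rewrite rmorph_prod; apply: eq_bigr => j _.
by case: (g j) => m; rewrite /= rmorphXn.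
Qed.

Lemma rmorph_bernstein i g :
  f (bernstein x xV i g) = bernstein (f \o x) (f \o xV) i g.
Proof.
have E h : f (bernstein_pos x xV i h) = bernstein_pos (f \o x) (f \o xV) i h.
  by rewrite rmorph_sum; apply: eq_bigr => k _; apply: rmorph_xmon.
rewrite /bernstein (fun_if f) rmorphN; congr (if _ then _ else - _); apply: E.
Qed.

Lemma hecke_rel_map q u w : hecke_rel T x xV q u w ->
  hecke_rel (f \o T) (f \o x) (f \o xV) q (f u) (f w).
Proof.
case=> [j|j|j k|i k ik|i k ik|i|i g];
  rewrite ?rmorphXn ?rmorphD ?rmorphM ?rmorph1 /= ?linearZ /=.
- exact: (hecke_xxV (f \o T) (f \o x) (f \o xV)).
- exact: (hecke_xVx (f \o T) (f \o x) (f \o xV)).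
- exact: (hecke_xx (f \o T) (f \o x) (f \o xV)).
- exact: (hecke_TT (f \o T) (f \o x) (f \o xV)).
- exact: (hecke_braid (f \o T) (f \o x) (f \o xV)).
- exact: (hecke_quad (f \o T) (f \o x) (f \o xV)).
- rewrite !rmorph_xmon rmorph_bernstein.
  exact: (hecke_bernstein (f \o T) (f \o x) (f \o xV)).
Qed.

(** Both sides of a relation are expressions in the generators, so they lift along [f]. With [f] the
    projection from the free algebra, a relation in [affhecke] comes from an element of the defining
    ideal. *)
Lemma hecke_rel_preim q u w :
    hecke_rel (f \o T) (f \o x) (f \o xV) q u w ->
  exists u' w', [/\ hecke_rel T x xV q u' w', f u' = u & f w' = w].
Proof.
case=> [j|j|j k|i k ik|i k ik|i|i g].
- by exists (x j * xV j), 1; rewrite rmorphM rmorph1; split=> //; constructor.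
- by exists (xV j * x j), 1; rewrite rmorphM rmorph1; split=> //; constructor.
- by exists (x j * x k), (x k * x j); rewrite !rmorphM; split=> //; constructor.
- by exists (T i * T k), (T k * T i); rewrite !rmorphM; split=> //; constructor.
- by exists (T i * T k * T i), (T k * T i * T k); rewrite !rmorphM; split=> //;
    constructor.
- exists (T i ^+ 2), ((q - q^-1) *: T i + 1).
  by rewrite rmorphD rmorphXn rmorph1 /= linearZ; split=> //; constructor.
- exists (xmon x xV g * T i),
    (T i * xmon x xV (swap i g) + (q - q^-1) *: bernstein x xV i g).
  rewrite rmorphD !rmorphM /= linearZ /= !rmorph_xmon rmorph_bernstein.
  by split=> //; constructor.
Qed.

End HeckeRelMorphism.

Section Presentation.
Variables (C : fieldType) (n : nat) (q : C).
Local Notation H := (affhecke n q).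
Local Notation F := (freealg C (hletter n)).

Definition free_to_hecke (z : F) : H := \pi z.

Lemma free_to_heckeB : {morph free_to_hecke : u w / u - w}.
Proof. by move=> u w; rewrite /free_to_hecke; rewrite !piE. Qed.

Lemma free_to_heckeM : {morph free_to_hecke : u w / u * w}.
Proof. exact: pi_mul_quotalg. Qed.

Lemma free_to_hecke1 : free_to_hecke 1 = 1.
Proof. by rewrite /free_to_hecke {2}/GRing.one /= piE. Qed.

Lemma free_to_heckeZ c : {morph free_to_hecke : u / c *: u}.
Proof. exact: pi_scale_quotalg. Qed.

HB.instance Definition _ :=
  GRing.isZmodMorphism.Build F H free_to_hecke free_to_heckeB.
HB.instance Definition _ :=
  GRing.isMonoidMorphism.Build F H free_to_hecke (free_to_hecke1, free_to_heckeM).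
HB.instance Definition _ :=
  GRing.isScalable.Build C F H *:%R free_to_hecke free_to_heckeZ.

Lemma free_to_hecke_surj h : exists z, h = free_to_hecke z.
Proof. by elim/quotW: h => z; exists z. Qed.

Lemma free_to_hecke_eq u w :
  free_to_hecke u = free_to_hecke w <->
  u - w \in gensub (two_sided_span (@affhecke_rel C n q)).
Proof. by rewrite idealrBE; split=> [E|/eqP E]; [apply/eqP|]. Qed.

Lemma free_subalg_ind (S : {pred F}) : GRing.subalg_closed S ->
  (forall a, letter C a \in S) -> forall z, z \in S.
Proof.
move=> cS Sl z.
have S0 : 0 \in S by case: cS => S1 SZ _; rewrite -(subrr 1) -scaleN1r addrC SZ.
have Sm (m : {fmonom (hletter n)}) : (<< m >> : F) \in S.
  case: m => s; elim: s => [|a s IHs].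
    have -> : (<< FMonom [::] >> : F) = 1 by congr << _ >>; apply/val_inj; rewrite /= fm1.
    by case: cS.
  have -> : (<< FMonom (a :: s) >> : F) = letter C a * << FMonom s >>.
    rewrite malgM_def fgmulUU mulr1; congr << _ >>.
    by apply/val_inj; rewrite /= /mmul /= fmmulE fmuE.
  by case: cS (cS) => _ _ SM _; apply: SM.
rewrite [z]monalgE; apply: (big_ind (fun u : F => u \in S)) => // [u w Su Sw|m _].
  by case: cS => _ SZ _; rewrite -[u]scale1r; apply: SZ.
(* The added 0 gives the shape [c *: u + w] in which [subalg_closed] expresses linearity. *)
have -> : << z@_m *g m >> = z@_m *: (<< m >> : F) + 0.
  by rewrite addr0 -[RHS]mul_malgC malgM_def fgmulUU mulr1 mul1m.
by case: cS => _ SZ _; apply: SZ.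
Qed.

Lemma affhecke_ind (S : {pred H}) : GRing.subalg_closed S ->
    (forall i, hT q i \in S) -> (forall j, hx q j \in S) ->
    (forall j, hxV q j \in S) ->
  forall h, h \in S.
Proof.
move=> [S1 SZ SM] ST Sx SxV h; have [z ->] := free_to_hecke_surj h.
apply: (free_subalg_ind (S := [pred z | free_to_hecke z \in S])).
  split; first by rewrite inE rmorph1.
    by move=> c u w; rewrite !inE linearP; apply: SZ.
  by move=> u w; rewrite !inE rmorphM; apply: SM.
case=> [i|[j []]]; rewrite inE; [exact: ST|exact: Sx|exact: SxV].
Qed.

Lemma affhecke_relE (u w : H) :
  hecke_rel (@hT C n q) (@hx C n q) (@hxV C n q) q u w -> u = w.
Proof.
case/(@hecke_rel_preim _ _ F H free_to_hecke) => u' [w' [uw <- <-]].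
apply/free_to_hecke_eq/gensub_gen; exists 1, u', w', 1; split=> //.
by rewrite mul1r mulr1.
Qed.

Section Lift.
Variables (B : algType C).
Variables (T : 'I_n.-1 -> B) (x xV : 'I_n -> B).
Hypothesis relB : forall u w, hecke_rel T x xV q u w -> u = w.

Let val_letter (a : hletter n) : B :=
  match a with
  | inl i => T i
  | inr (j, true) => x j
  | inr (j, false) => xV j
  end.

Let val_word (m : {fmonom (hletter n)}) : B :=
  \prod_(a <- (m : seq (hletter n))) val_letter a.

Let val_word_morph : mmorphism val_word.
Proof.
split; last by rewrite /val_word fm1 big_nil.
by move=> m1 m2; rewrite /val_word /mmul /= fmmulE big_cat.
Qed.
HB.instance Definition _ := isMultiplicative.Build _ _ val_word val_word_morph.

Let lift0 (z : F) : B := mmap (in_alg B) val_word z.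

Let lift0B : {morph lift0 : u w / u - w}.
Proof. exact: raddfB. Qed.
Let lift0M : GRing.monoid_morphism lift0.
Proof.
have /commr_mmap_is_multiplicative [M1 M2] :
  forall (g : F) m m', GRing.comm (in_alg B g@_m) (val_word m').
  by move=> g m m'; rewrite /GRing.comm /= mulr_algl mulr_algr.
by split.
Qed.
Let lift0Z c : {morph lift0 : u / c *: u}.
Proof. by move=> u; rewrite /lift0 mmapZ mulr_algl. Qed.

HB.instance Definition _ := GRing.isZmodMorphism.Build F B lift0 lift0B.
HB.instance Definition _ := GRing.isMonoidMorphism.Build F B lift0 lift0M.
HB.instance Definition _ := GRing.isScalable.Build C F B *:%R lift0 lift0Z.

Let lift0_ideal z :
  z \in gensub (two_sided_span (@affhecke_rel C n q)) -> lift0 z = 0.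
Proof.
move=> Iz; apply/eqP; apply: (gensub_min (P := [pred z | lift0 z == 0])) Iz.
  split; first by rewrite inE rmorph0.
  by move=> u w; rewrite !inE rmorphB => /eqP Hu /eqP Hw; rewrite /= Hu Hw subrr.
move=> s [a [u [w [b [uw ->]]]]].
have l_letter a' : lift0 (letter C a') = val_letter a'.
  by rewrite /lift0 mmapU /= scale1r mul1r /val_word fmuE big_seq1.
have Euw : lift0 u = lift0 w.
  apply: relB; have := hecke_rel_map lift0 uw.
  congr (hecke_rel _ _ _ q _ _); apply/funext => k /=; exact: l_letter.
by rewrite inE !rmorphM rmorphB /= Euw subrr mulr0 mul0r.
Qed.

(** Universal property of the presentation: evaluation of noncommutative polynomials kills the ideal
    of relations, so its value does not depend on the representative chosen by [repr]. *)
Lemma affhecke_lift : exists f : {lrmorphism H -> B},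
  [/\ forall i, f (hT q i) = T i, forall j, f (hx q j) = x j
    & forall j, f (hxV q j) = xV j].
Proof.
pose f (h : H) : B := lift0 (repr h).
have fE z : f (free_to_hecke z) = lift0 z.
  apply/eqP; rewrite -subr_eq0 -rmorphB; apply/eqP/lift0_ideal.
  by apply/free_to_hecke_eq; rewrite /free_to_hecke reprK.
have fB : {morph f : u w / u - w}.
  move=> u w; have [z ->] := free_to_hecke_surj u.
  by have [y ->] := free_to_hecke_surj w; rewrite -rmorphB !fE rmorphB.
have fM : GRing.monoid_morphism f.
  split=> [|u w]; first by rewrite -(rmorph1 free_to_hecke) fE rmorph1.
  have [z ->] := free_to_hecke_surj u.
  by have [y ->] := free_to_hecke_surj w; rewrite -rmorphM !fE rmorphM.
have fZ : scalable f.
  move=> c u; have [z ->] := free_to_hecke_surj u.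
  by rewrite -linearZ !fE linearZ.
pose fBi := GRing.isZmodMorphism.Build H B f fB.
pose fMi := GRing.isMonoidMorphism.Build H B f fM.
pose fZi := GRing.isScalable.Build C H B *:%R f fZ.
pose g : {lrmorphism H -> B} := HB.pack f fBi fMi fZi.
have l_letter a' : lift0 (letter C a') = val_letter a'.
  by rewrite /lift0 mmapU /= scale1r mul1r /val_word fmuE big_seq1.
by exists g; split=> k; rewrite /= [LHS]fE l_letter.
Qed.

End Lift.

End Presentation.

(** * Normal forms *)

Section LinearSpan.
Variables (C : fieldType) (V : lmodType C).

Definition lspan (s : seq V) : {pred V} := fun u =>
  `[< exists c : 'I_(size s) -> C, u = \sum_i c i *: s`_i >].

Lemma lspan_submod s : GRing.submod_closed (lspan s).
Proof.
split; first by apply/asboolP; exists (fun=> 0); rewrite big1 // => i _; rewrite scale0r.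
move=> a u w /asboolP[c ->] /asboolP[d ->]; apply/asboolP.
exists (fun i => a * c i + d i); rewrite scaler_sumr -big_split.
by apply: eq_bigr => i _; rewrite scalerDl scalerA.
Qed.

HB.instance Definition _ s := GRing.isSubmodClosed.Build C V (lspan s) (lspan_submod s).

Lemma mem_lspan s : {subset s <= lspan s}.
Proof.
move=> u us; apply/asboolP; have ltu : (index u s < size s)%N by rewrite index_mem.
exists (fun i => (i == Ordinal ltu)%:R).
rewrite (bigD1 (Ordinal ltu)) //= eqxx scale1r nth_index // big1 ?addr0 // => i.
by move/negbTE ->; rewrite scale0r.
Qed.

Lemma lspan_min s (S : {pred V}) : GRing.submod_closed S ->
  {subset s <= S} -> {subset lspan s <= S}.
Proof.
move=> [S0 SZ] sS u /asboolP[c ->]; apply: (big_ind (fun v => v \in S)) => //.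
  by move=> v w Sv Sw; rewrite -[v]scale1r; apply: SZ.
by move=> i _; rewrite -[_ *: _]addr0; apply: SZ => //; apply/sS/mem_nth.
Qed.

End LinearSpan.

(* The standard normal form: the products of the words                        *)
(* T_(m-1) T_(m-2) .. T_(m-k), 0 <= k <= m, taken over increasing m.          *)
Section NormalForm.
Variables (C : fieldType) (H : algType C) (N : nat) (T : nat -> H) (c : C).
Hypothesis T_comm : forall i j, (i.+1 < j)%N -> (j < N)%N -> T i * T j = T j * T i.
Hypothesis T_braid : forall i, (i.+1 < N)%N ->
  T i * T i.+1 * T i = T i.+1 * T i * T i.+1.
Hypothesis T_quad : forall i, (i < N)%N -> T i ^+ 2 = c *: T i + 1.

Fixpoint descending_word m k : H :=
  if k is l.+1 then descending_word m l * T (m - l.+1) else 1.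

Fixpoint normal_forms m : seq H :=
  if m is l.+1 then
    [seq a * descending_word l k | a <- normal_forms l, k <- iota 0 m]
  else [:: 1].

Lemma size_normal_forms m : size (normal_forms m) = m`!.
Proof.
by elim: m => [//|m IHm]; rewrite /normal_forms -/normal_forms size_allpairs IHm
  size_iota mulnC.
Qed.

Lemma normal_formsSP m u : u \in normal_forms m.+1 ->
  exists a k, [/\ a \in normal_forms m, (k <= m)%N & u = a * descending_word m k].
Proof.
rewrite /normal_forms -/normal_forms => /allpairsP[[a k] [am]].
by rewrite mem_iota => km ->; exists a, k.
Qed.

Lemma descending_word_comm m k j : (m <= N)%N -> (k <= m)%N -> (j.+1 < m - k)%N ->
  descending_word m k * T j = T j * descending_word m k.
Proof.
move=> mN; elim: k => [|k IHk] km jk /=; first by rewrite mul1r mulr1.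
rewrite -mulrA -T_comm; [|lia|lia].
by rewrite !mulrA IHk //; lia.
Qed.

(** Coming from the right, [T j] commutes with the letters of index below [j.-1], meets
    [T j * T j.-1], and the braid relation replaces it by a [T j.-1] on the left, which commutes
    with the remaining letters, all of index above [j]. *)
Lemma descending_word_shift m k j : (m <= N)%N -> (k <= m)%N ->
    (m - k < j)%N -> (j < m)%N ->
  descending_word m k * T j = T j.-1 * descending_word m k.
Proof.
move=> mN; elim: k => [|k IHk] km kj jm /=; first by lia.
have [jk|jk] := eqVneq j (m - k)%N; last first.
  rewrite -mulrA T_comm; [|lia|lia].
  by rewrite !mulrA IHk //; lia.
case: k jk km kj {IHk} => [|k] jk km kj /=; first by lia.
have -> : (m - k.+1 = j)%N by lia.
have -> : (m - k.+2 = j.-1)%N by lia.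
have := @T_braid j.-1; rewrite prednK; last by lia.
move=> br; rewrite -!mulrA (mulrA (T j)) -br; last by lia.
by rewrite !mulrA descending_word_comm //; lia.
Qed.

Lemma lspan_normal_formsM m a k : (k <= m)%N -> a \in lspan (normal_forms m) ->
  a * descending_word m k \in lspan (normal_forms m.+1).
Proof.
move=> km; apply: (lspan_min (S := [pred u | u * descending_word m k
  \in lspan (normal_forms m.+1)])).
  split; first by rewrite inE mul0r rpred0.
  by move=> d u w; rewrite !inE mulrDl -scalerAl => Su Sw; rewrite rpredD ?rpredZ.
move=> b bm; rewrite inE; apply: mem_lspan.
by apply: allpairs_f => //; rewrite mem_iota; lia.
Qed.

(** Multiply [b * descending_word m k] by [T j]. If j = m-k-1 the word gets longer; if j = m-k its
    last letter is squared and the quadratic relation applies. In all other cases a generator passes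
    to the left of the word, as [T j] or as [T j.-1], and is absorbed into [b] by induction. *)
Lemma normal_forms_stable m j a : (m <= N.+1)%N -> (j.+1 < m)%N ->
  a \in lspan (normal_forms m) -> a * T j \in lspan (normal_forms m).
Proof.
elim: m j a => [|m IHm] j a; rewrite ?ltn0 // => mN jm.
apply: (lspan_min (S := [pred u | u * T j \in lspan (normal_forms m.+1)])).
  split; first by rewrite inE mul0r rpred0.
  by move=> d u w; rewrite !inE mulrDl -scalerAl => Su Sw; rewrite rpredD ?rpredZ.
move=> u /normal_formsSP[b [k [bm km ->]]]; rewrite inE.
have bS : b \in lspan (normal_forms m) by apply: mem_lspan.
have [ejk|njk] := eqVneq j.+1 (m - k)%N.
  have -> : j = (m - k.+1)%N by lia.
  by rewrite -mulrA; apply: (@lspan_normal_formsM _ _ k.+1) => //; lia.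
have [ltjk|] := ltnP j.+1 (m - k).
  rewrite -mulrA descending_word_comm ?mulrA; [|lia..].
  by apply: lspan_normal_formsM; [lia | apply: IHm => //; lia].
move=> gejk; have [ejk|njk'] := eqVneq j (m - k)%N.
  case: k km njk gejk ejk => [|k] km njk gejk ejk; first by lia.
  rewrite -mulrA /= -ejk -mulrA -expr2 T_quad; last by lia.
  rewrite mulrDr mulr1 mulrDr -!scalerAr ejk rpredD ?rpredZ //.
    by apply: (@lspan_normal_formsM _ _ k.+1) => //; lia.
  by apply: (@lspan_normal_formsM _ _ k) => //; lia.
rewrite -mulrA descending_word_shift ?mulrA; [|lia..].
by apply: lspan_normal_formsM; [lia | apply: IHm => //; lia].
Qed.

Lemma normal_forms_generated m (S : {pred H}) : (m <= N.+1)%N ->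
    GRing.mulr_closed S -> (forall i, (i < N)%N -> T i \in S) ->
  {subset normal_forms m <= S}.
Proof.
move=> mN [S1 SM] ST; elim: m mN => [|m IHm] mN u; first by rewrite inE => /eqP ->.
move=> /normal_formsSP[b [k [bm km ->]]]; apply: (SM _ _).
  by apply: IHm => //; lia.
elim: k km => [|k IHk] km //=; apply: (SM _ _); [apply: IHk|apply: ST]; lia.
Qed.

Lemma normal_forms1 m : 1 \in normal_forms m.
Proof.
elim: m => [|m IHm]; first by rewrite inE.
by rewrite -[1]mulr1; apply: (@allpairs_f _ _ _ (fun a k => a * descending_word m k)
  _ _ 1 0%N).
Qed.

Lemma normal_formsMl a b : b \in lspan (normal_forms N.+1) ->
  a \in lspan (normal_forms N.+1) -> a * b \in lspan (normal_forms N.+1).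
Proof.
pose S := [pred b | `[< forall a, a \in lspan (normal_forms N.+1) ->
  a * b \in lspan (normal_forms N.+1) >]].
move=> bm; have /asboolP : b \in S; last by apply.
move: b bm; apply: lspan_min.
  split; first by apply/asboolP=> u _; rewrite mulr0 rpred0.
  move=> d u w /asboolP Su /asboolP Sw; apply/asboolP => v vm.
  by rewrite mulrDr -scalerAr rpredD ?rpredZ ?Su ?Sw.
apply: normal_forms_generated => //; last first.
  by move=> i iN; apply/asboolP => u um; apply: normal_forms_stable.
split; first by apply/asboolP => u; rewrite mulr1.
move=> u w /asboolP Su /asboolP Sw; apply/asboolP => v vm.
by rewrite mulrA; apply/Sw/Su.
Qed.

End NormalForm.

Section ScalarAction.
Variables (C : fieldType) (A : algType C) (M : lmodType A).

Lemma scaler_algA c d (w : M) : (c%:A : A) *: ((d%:A : A) *: w) = ((c * d)%:A : A) *: w.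
Proof. by rewrite scalerA mulr_algl scalerA. Qed.

Lemma scaler_algC (h : A) c (w : M) : h *: ((c%:A : A) *: w) = (c%:A : A) *: (h *: w).
Proof. by rewrite !scalerA mulr_algl mulr_algr. Qed.

Lemma scaler_alg_scale c (h : A) (w : M) : (c *: h) *: w = (c%:A : A) *: (h *: w).
Proof. by rewrite scalerA mulr_algl. Qed.

End ScalarAction.

Lemma xmon_single n (A : pzRingType) (x xV : 'I_n -> A) j k :
  xmon x xV [ffun l => if l == j then k else 0] = xpow x xV j k.
Proof.
rewrite /xmon (eq_bigr (fun l => if l == j then xpow x xV l k else 1)).
  by rewrite -big_mkcond big_pred1_eq.
by move=> l _; rewrite ffunE; case: eqP => //= _; rewrite expr0.
Qed.

(** * Spanning the module generated by a weight vector *)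

Section WeightVector.
Variables (C : fieldType) (n : nat) (q : C) (H : algType C).
Variables (T : 'I_n.-1 -> H) (x xV : 'I_n -> H).
Hypothesis relH : forall u w, hecke_rel T x xV q u w -> u = w.
Hypothesis genH : forall S : {pred H}, GRing.subalg_closed S ->
  (forall i, T i \in S) -> (forall j, x j \in S) -> (forall j, xV j \in S) ->
  forall h, h \in S.
Variables (M : lmodType H) (w : M) (t : 'I_n -> C).
Hypothesis n_gt0 : (0 < n)%N.
Hypothesis xw : forall j, x j *: w = ((t j)%:A : H) *: w.
Hypothesis t_neq0 : forall j, t j != 0.

Lemma xV_weight j : xV j *: w = (((t j)^-1)%:A : H) *: w.
Proof.
have E : xV j * x j = 1 by apply: relH; constructor.
have Ew : w = xV j *: (x j *: w) by rewrite scalerA E scale1r.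
by rewrite [in RHS]Ew xw scaler_algC scaler_algA mulVf // !scale1r.
Qed.

Lemma xmon_weight g : exists c : C, xmon x xV g *: w = (c%:A : H) *: w.
Proof.
apply: (big_ind (fun h : H => exists c : C, h *: w = (c%:A : H) *: w)).
- by exists 1; rewrite !scale1r.
- move=> h h' [c ch] [d dh]; exists (d * c).
  by rewrite -(scalerA h) dh scaler_algC ch scaler_algA.
move=> j _; have pow (h : H) c m :
    h *: w = (c%:A : H) *: w -> (h ^+ m) *: w = ((c ^+ m)%:A : H) *: w.
  move=> ch; elim: m => [|m IHm]; first by rewrite !expr0 !scale1r.
  by rewrite exprSr exprS -(scalerA (h ^+ m)) ch scaler_algC IHm scaler_algA.
by case: (g j) => m; eexists; [apply: pow (xw j) | apply: pow (xV_weight j)].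
Qed.

Lemma xmon_T g i : xmon x xV g * T i =
  T i * xmon x xV (swap i g) +
  (q - q^-1) *: bernstein x xV i g.
Proof. by apply: relH; constructor. Qed.

Let Tnat (k : nat) : H := if insub k is Some i then T i else 0.
Let TnatE (i : 'I_n.-1) : Tnat i = T i.
Proof. by rewrite /Tnat valK. Qed.

Let NF := normal_forms Tnat n.
(** Equality is asked only after application to [w], where monomials in the x_j become scalars. *)
Let reach (h : H) := exists2 a, a \in lspan NF & h *: w = a *: w.

Let reachD h h' : reach h -> reach h' -> reach (h + h').
Proof.
move=> [a aN ah] [b bN bh]; exists (a + b); first exact: rpredD.
by rewrite !scalerDl ah bh.
Qed.

Let reachZ c h : reach h -> reach (c *: h).
Proof.
move=> [a aN ah]; exists (c *: a); first exact: rpredZ.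
by rewrite scaler_alg_scale ah -scaler_alg_scale.
Qed.

Let T_comm i j : (i.+1 < j)%N -> (j < n.-1)%N -> Tnat i * Tnat j = Tnat j * Tnat i.
Proof.
move=> ij jn; have iN : (i < n.-1)%N by apply: ltn_trans jn; apply: ltnW.
rewrite (TnatE (Ordinal iN)) (TnatE (Ordinal jn)); apply: relH.
by constructor; rewrite /= ij.
Qed.

Let T_braid i : (i.+1 < n.-1)%N ->
  Tnat i * Tnat i.+1 * Tnat i = Tnat i.+1 * Tnat i * Tnat i.+1.
Proof.
move=> jn; have iN : (i < n.-1)%N by apply: ltnW.
rewrite (TnatE (Ordinal iN)) (TnatE (Ordinal jn)); apply: relH.
by constructor.
Qed.

Let T_quad i : (i < n.-1)%N -> Tnat i ^+ 2 = (q - q^-1) *: Tnat i + 1.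
Proof.
move=> iN; rewrite (TnatE (Ordinal iN)); apply: relH; constructor.
Qed.

Let NF_mul a b : a \in lspan NF -> b \in lspan NF -> a * b \in lspan NF.
Proof.
rewrite /NF -(prednK n_gt0) => aN bN.
exact: (normal_formsMl T_comm T_braid T_quad).
Qed.

Let T_NF i : T i \in lspan NF.
Proof.
rewrite -TnatE; have: (i < n.-1)%N by []; move: (nat_of_ord i) => k ki.
rewrite -[Tnat k]mul1r /NF -(prednK n_gt0).
apply: (normal_forms_stable T_comm T_braid T_quad) => //.
by apply/mem_lspan/normal_forms1.
Qed.

(** The Bernstein relation carries a monomial across one letter [T i] at the cost of other
    monomials, so the induction on words is run for all exponents [g] together. After the last
    letter the monomial meets [w] and acts by a scalar. *)
Let xmon_reach a g : a \in lspan NF -> reach (xmon x xV g * a).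
Proof.
have reach0 : reach 0 by exists 0; rewrite ?rpred0.
move=> aN; move: a aN g.
pose S := [pred a | `[< forall g, reach (xmon x xV g * a) >]].
suff sub : {subset lspan NF <= S} by move=> a /sub /asboolP.
have subS : GRing.submod_closed S.
  split; first by apply/asboolP => g; rewrite mulr0.
  move=> c u v /asboolP Su /asboolP Sv; apply/asboolP => g.
  by rewrite mulrDr -scalerAr; apply: reachD => //; apply: reachZ.
apply: lspan_min => // b bN.
(* The left multipliers that preserve [S] are closed under products, which reduces a normal form to
   its single letters. *)
pose S' := [pred b | `[< forall a, a \in S -> b * a \in S >]].
have : b \in S'.
  apply: (normal_forms_generated (N := n.-1) (m := n)) bN; first by rewrite prednK.
    split; first by apply/asboolP => a; rewrite mul1r.
    move=> u v /asboolP Su /asboolP Sv; apply/asboolP => a aS.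
    by rewrite -mulrA; apply/Su/Sv.
  move=> i iN; rewrite (TnatE (Ordinal iN)); move: (Ordinal iN) => {iN}i.
  apply/asboolP => a /asboolP Sa; apply/asboolP => g.
  have Tr h : reach h -> reach (T i * h).
    move=> [u uN uh]; exists (T i * u); first exact: NF_mul (T_NF i) uN.
    by rewrite -(scalerA (T i)) uh scalerA.
  rewrite mulrA xmon_T mulrDl -mulrA -scalerAl; apply: reachD; first exact: Tr.
  apply: reachZ; have pos f : reach (bernstein_pos x xV i f * a).
    rewrite mulr_suml; apply: (big_ind reach) => //.
  rewrite /bernstein; case: ifP => // _.
  by rewrite mulNr -scaleN1r; apply: reachZ.
move/asboolP/(_ 1); rewrite mulr1; apply; apply/asboolP => g.
rewrite mulr1; have [c cg] := xmon_weight g.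
exists c%:A => //; apply: rpredZ; exact/mem_lspan/normal_forms1.
Qed.

(** The vectors a w, with a in the span of the normal forms, are stable under the [T i] by the
    reduction of words and under the [x j] and [xV j] by [xmon_reach]. Quantifying over a makes the
    set of admissible h closed under products. *)
Lemma weight_vector_span : exists s : seq H, size s = n`! /\
  forall h, exists2 a, a \in lspan s & h *: w = a *: w.
Proof.
exists NF; split; first exact: size_normal_forms.
pose S := [pred h : H | `[< forall a, a \in lspan NF -> reach (h * a) >]].
have xS j k : xpow x xV j k \in S.
  by apply/asboolP => a aN; rewrite -xmon_single; apply: xmon_reach.
move=> h; have /asboolP/(_ 1) : h \in S.
  apply: genH => [|i|j|j]; first split.
  - by apply/asboolP => a aN; rewrite mul1r; exists a.
  - move=> c u v /asboolP Su /asboolP Sv; apply/asboolP => a aN.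
    by rewrite mulrDl -scalerAl; apply: reachD; [apply/reachZ/Su | apply: Sv].
  - move=> u v /asboolP Su /asboolP Sv; apply/asboolP => a /Sv[b bN ab].
    have [d dN bd] := Su b bN; exists d => //.
    by rewrite -mulrA -(scalerA u) ab scalerA.
  - by apply/asboolP => a aN; exists (T i * a) => //; apply: NF_mul (T_NF i) aN.
  - exact: (xS j 1).
  - exact: (xS j (-1)).
by rewrite mulr1; apply; apply/mem_lspan/normal_forms1.
Qed.

End WeightVector.

(** * The seminormal module *)

Section Seminormal.
Variables (C : fieldType) (n : nat) (q : C).
Implicit Types (i k : 'I_n.-1) (j : 'I_n) (s : {perm 'I_n}).

(* In the tableau module of a ribbon, s j is the number of the box holding j,  *)
(* whose content is s j; here all permutations are kept at once.              *)
Definition wt s j : C := q ^+ (2 * s j).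
(** This is the coefficient [T_diag] for the contents [s (lo i)] and [s (hi i)], with numerator and
    denominator multiplied by the weight at [hi i]. *)
Definition sn_diag i s : C :=
  (q - q^-1) * wt s (hi i) / (wt s (hi i) - wt s (lo i)).
Definition sn_off i s : C := q^-1 + sn_diag i s.
Definition sw i s : {perm 'I_n} := (simple i * s)%g.

Lemma swK i : involutive (sw i).
Proof. by move=> s; rewrite /sw mulgA tperm2 mul1g. Qed.

Lemma swE i s j : sw i s j = s (simple i j).
Proof. by rewrite permM. Qed.

Lemma wt_sw i s j : wt (sw i s) j = wt s (simple i j).
Proof. by rewrite /wt swE. Qed.

Lemma simple_lo i : simple i (lo i) = hi i. Proof. exact: tpermL. Qed.
Lemma simple_hi i : simple i (hi i) = lo i. Proof. exact: tpermR. Qed.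

Lemma simple_far i k : (i.+1 < k)%N || (k.+1 < i)%N ->
  simple i (lo k) = lo k /\ simple i (hi k) = hi k.
Proof. by move=> ik; split; apply: tpermD; rewrite -val_eqE /=; lia. Qed.

Lemma sw_comm i k s : (i.+1 < k)%N || (k.+1 < i)%N -> sw i (sw k s) = sw k (sw i s).
Proof.
move=> ik; rewrite /sw !mulgA; congr (_ * _)%g.
have [h1 h2] := simple_far ik.
by rewrite [RHS]conjgC tpermJ h1 h2.
Qed.

Lemma sw_braid i k s : k = i.+1 :> nat -> sw i (sw k (sw i s)) = sw k (sw i (sw k s)).
Proof.
move=> ik; rewrite /sw !mulgA; congr (_ * _)%g.
have hik : hi i = lo k by apply/val_inj.
(* Each side is a transposition conjugated by a transposition, and both conjugates exchange [lo i]
   and [hi k]. *)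
have conj (a b : {perm 'I_n}) : (b * b = 1 -> b * a * b = a ^ b)%g.
  by move=> bb; rewrite /conjg mulgA; congr (_ * _ * _)%g; apply/eqP; rewrite eq_sym eq_invg_mul bb.
rewrite !conj ?tperm2 // !tpermJ /simple hik tpermR.
have nik : lo i != hi k by rewrite -val_eqE /=; lia.
have nk : lo k != hi k by apply: lo_neq_hi.
have ni : lo k != lo i by rewrite -hik eq_sym; apply: lo_neq_hi.
rewrite tpermL (tpermD nik nk) (tpermD ni) 1?eq_sym //.
Qed.

Hypothesis q_neq0 : q != 0.
Hypothesis q_not_root : forall m : nat, (0 < m)%N -> q ^+ m != 1.

Lemma wt_neq0 s j : wt s j != 0.
Proof. exact: expf_neq0. Qed.

Lemma expq_inj : injective (fun m : nat => q ^+ m).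
Proof.
suff lt m m' : q ^+ m = q ^+ m' -> ~~ (m < m')%N.
  move=> m m' /= E; apply/eqP; rewrite eqn_leq.
  by apply/andP; split; rewrite leqNgt; [apply: (lt m' m) | apply: (lt m m')].
move=> E; apply/negP => lt; have := @q_not_root (m' - m)%N.
rewrite subn_gt0 lt => /(_ isT)/negP; apply; apply/eqP.
apply: (mulfI (expf_neq0 m q_neq0)).
by rewrite mulr1 -exprD subnKC // ltnW.
Qed.

Lemma wt_inj s : injective (wt s).
Proof.
move=> j k /expq_inj /eqP; rewrite eqn_mul2l /= => /eqP E.
by apply/(@perm_inj _ s)/val_inj.
Qed.

Variables (D : nat) (ix : 'I_D -> {perm 'I_n}) (xi : {perm 'I_n} -> 'I_D).
Hypothesis ixK : cancel ix xi.
Hypothesis xiK : cancel xi ix.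
Implicit Types (u : 'cV[C]_D).

Definition snT i : 'M[C]_D := \matrix_(r, t)
  (sn_diag i (ix r) *+ (r == t) + sn_off i (ix t) *+ (ix t == sw i (ix r))).
Definition snX j : 'M[C]_D := \matrix_(r, t) (wt (ix r) j *+ (r == t)).
Definition snXV j : 'M[C]_D := \matrix_(r, t) ((wt (ix r) j)^-1 *+ (r == t)).

Lemma snTE i u s : (snT i *m u) (xi s) 0 =
  sn_diag i s * u (xi s) 0 + sn_off i (sw i s) * u (xi (sw i s)) 0.
Proof.
rewrite mxE (eq_bigr (fun t =>
  (if t == xi s then sn_diag i s * u t 0 else 0) +
  (if t == xi (sw i s) then sn_off i (sw i s) * u t 0 else 0))).
  by rewrite big_split -!big_mkcond /= !big_pred1_eq.
move=> t _; rewrite mxE xiK mulrDl !mulrb (eq_sym (xi s)) (can2_eq ixK xiK).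
by congr (_ + _); case: eqP => [->|_]; rewrite ?mul0r ?xiK.
Qed.

Lemma snXE j u s : (snX j *m u) (xi s) 0 = wt s j * u (xi s) 0.
Proof.
rewrite mxE (bigD1 (xi s)) //= mxE eqxx xiK big1 ?addr0 // => t ts.
by rewrite mxE eq_sym (negbTE ts) mul0r.
Qed.

Lemma snXVE j u s : (snXV j *m u) (xi s) 0 = (wt s j)^-1 * u (xi s) 0.
Proof.
rewrite mxE (bigD1 (xi s)) //= mxE eqxx xiK big1 ?addr0 // => t ts.
by rewrite mxE eq_sym (negbTE ts) mul0r.
Qed.

(** Comparing one coordinate of the image of a generic vector turns a relation between operators
    into an identity of rational functions in the weights. *)
Lemma mx_ext (A B : 'M[C]_D) :
  (forall u s, (A *m u) (xi s) 0 = (B *m u) (xi s) 0) -> A = B.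
Proof.
move=> AB; apply/matrixP => r t; have := AB (delta_mx t 0) (ix r).
by rewrite ixK -!colE !mxE.
Qed.

End Seminormal.

Section SeminormalRelations.
Variables (C : fieldType) (n : nat) (q : C).
Hypothesis q_neq0 : q != 0.
Hypothesis q_not_root : forall m : nat, (0 < m)%N -> q ^+ m != 1.
Variables (d : nat) (ix : 'I_d.+1 -> {perm 'I_n}) (xi : {perm 'I_n} -> 'I_d.+1).
Hypothesis ixK : cancel ix xi.
Hypothesis xiK : cancel xi ix.
Implicit Types (i k : 'I_n.-1) (j : 'I_n) (s : {perm 'I_n}) (u : 'cV[C]_d.+1).
Local Notation T := (@snT C n q d.+1 ix).
Local Notation X := (@snX C n q d.+1 ix).
Local Notation XV := (@snXV C n q d.+1 ix).

Lemma sn_xmon g u s : (xmon X XV g *m u) (xi s) 0 =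
  xmon (wt q s) (fun j => (wt q s j)^-1) g * u (xi s) 0.
Proof.
pose K (A : 'M[C]_d.+1) (c : C) := forall u, (A *m u) (xi s) 0 = c * u (xi s) 0.
suff : K (xmon X XV g) (xmon (wt q s) (fun j => (wt q s j)^-1) g) by apply.
have KM A A' c c' : K A c -> K A' c' -> K (A * A') (c * c').
  by move=> KA KA' v; rewrite -mulmxA KA KA' mulrA.
have K1 : K 1 1 by move=> v; rewrite mul1mx mul1r.
have KX A c m : K A c -> K (A ^+ m) (c ^+ m).
  by move=> KA; elim: m => [|m IHm]; rewrite ?expr0 ?exprS; auto.
apply: (@big_ind2 _ _ K) => // [A c A' c'|j _]; first exact: KM.
 by case: (g j) => m; apply: KX => v; [apply: snXE | apply: snXVE].
Qed.

Lemma sn_bernstein i g u s : (bernstein X XV i g *m u) (xi s) 0 =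
  bernstein (wt q s) (fun j => (wt q s j)^-1) i g * u (xi s) 0.
Proof.
have pos h : (bernstein_pos X XV i h *m u) (xi s) 0 =
    bernstein_pos (wt q s) (fun j => (wt q s j)^-1) i h * u (xi s) 0.
  rewrite mulmx_suml summxE mulr_suml; apply: eq_bigr => k _; exact: sn_xmon.
rewrite /bernstein; case: ifP => _; first exact: pos.
by rewrite mulNmx mulNr mxE pos.
Qed.

(** The coordinate at [s] involves only the permutations reached from [s] by the swaps in the
    relation: two for the quadratic relation, four for commutation, six for the braid relation. As
    [wt_inj] makes every denominator nonzero, what remains are rational identities. *)
Lemma seminormal_rel a b : hecke_rel T X XV q a b -> a = b.
Proof.
have wn s i : wt q s (hi i) - wt q s (lo i) != 0.
  by rewrite subr_eq0 (inj_eq (@wt_inj _ _ _ q_neq0 q_not_root s)) // eq_sym lo_neq_hi.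
have wn' s i : wt q s (lo i) - wt q s (hi i) != 0.
  by rewrite subr_eq0 (inj_eq (@wt_inj _ _ _ q_neq0 q_not_root s)) // lo_neq_hi.
case=> [j|j|j k|i k ik|i k ik|i|i g]; apply: (mx_ext ixK) => u s.
- by rewrite -mulmxA snXE // snXVE // mul1mx mulrA mulfV ?mul1r ?wt_neq0.
- by rewrite -mulmxA snXVE // snXE // mul1mx mulrA mulVf ?mul1r ?wt_neq0.
- by rewrite -!mulmxA !snXE // mulrCA.
- have [h1 h2] := simple_far ik; rewrite orbC in ik.
  have [h3 h4] := simple_far ik.
  rewrite -!mulmxA !snTE // (sw_comm s ik) /sn_off /sn_diag !wt_sw.
  rewrite !(simple_lo, simple_hi, h1, h2, h3, h4).
  by ring.
- have lk : hi i = lo k by apply/val_inj.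
  have p13 : lo i != hi k by rewrite -val_eqE /=; lia.
  have p12 := lo_neq_hi i; have p23 := lo_neq_hi k; rewrite lk in p12.
  have h1 : simple i (lo i) = lo k by rewrite simple_lo.
  have h2 : simple i (lo k) = lo i by rewrite -lk simple_hi.
  have h3 : simple i (hi k) = hi k by rewrite /simple lk tpermD.
  have h4 : simple k (lo i) = lo i by rewrite /simple tpermD // eq_sym.
  have w12 : wt q s (lo k) - wt q s (lo i) != 0 by rewrite -lk.
  have w23 := wn s k.
  have w13 : wt q s (hi k) - wt q s (lo i) != 0.
    by rewrite subr_eq0 (inj_eq (@wt_inj _ _ _ q_neq0 q_not_root s)) // eq_sym.
  have w21 : wt q s (lo i) - wt q s (lo k) != 0 by rewrite -opprB oppr_eq0.
  have w32 : wt q s (lo k) - wt q s (hi k) != 0 by rewrite -opprB oppr_eq0.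
  have w31 : wt q s (lo i) - wt q s (hi k) != 0 by rewrite -opprB oppr_eq0.
  rewrite -!mulmxA !snTE // (sw_braid s ik) /sn_off /sn_diag !wt_sw lk.
  rewrite !(h1, h2, h3, h4, simple_lo, simple_hi) !swK.
  by field; rewrite q_neq0 w12 w13 w21 w23 w31 w32.
- have w1 := wn s i; have w2 := wn' s i.
  rewrite expr2 -mulmxA mulmxDl mul1mx -scalemxAl [RHS]mxE [X in _ = X + _]mxE.
  rewrite !snTE // swK /sn_off /sn_diag.
  rewrite !wt_sw simple_lo simple_hi; by field; rewrite q_neq0 w1 w2.
- have := bernsteinE i g (wt_neq0 q_neq0 s).
  rewrite mulmxDl -scalemxAl [RHS]mxE [X in _ = _ + X]mxE sn_bernstein -!mulmxA.
  rewrite snTE // !sn_xmon snTE // /sn_off /sn_diag.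
  (* Swapping both the exponents and the weights leaves the value of a monomial unchanged. *)
  have -> : xmon (wt q (sw i s)) (fun j => (wt q (sw i s) j)^-1) (swap i g) =
      xmon (wt q s) (fun j => (wt q s j)^-1) g.
    rewrite !xmon_field [RHS](reindex_inj (@perm_inj _ (simple i))) /=.
    by apply: eq_bigr => j _; rewrite wt_sw ffunE.
  move: (xmon _ _ g) (xmon _ _ (swap i g)) (bernstein _ _ _ _) => m m' b' E.
  (* The two weights being distinct, [bernsteinE] determines the Bernstein term by division. *)
  have -> : b' = (m - m') * wt q s (hi i) / (wt q s (hi i) - wt q s (lo i)).
    by rewrite -E mulfK.
  rewrite !wt_sw simple_lo simple_hi; field.
  by rewrite q_neq0 wn wn'.
Qed.
End SeminormalRelations.

(** * The induced module *)

Section TensorLift.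
Variables (A H : pzRingType) (f : {rmorphism A -> H}) (N : lmodType A).
Variables (V : zmodType) (g : H -> N -> V).
Hypothesis gDl : forall h h' v, g (h + h') v = g h v + g h' v.
Hypothesis gDr : forall h v v', g h (v + v') = g h v + g h v'.
Hypothesis g_bal : forall h a v, g (h * f a) v = g h (a *: v).
Local Notation Z := {malg int[(H * N)%type]}.

Definition malg_lift (z : Z) : V := \sum_(k <- msupp z) g k.1 k.2 *~ z@_k.

Lemma malg_liftB : {morph malg_lift : x y / x - y}.
Proof.
move=> x y; pose D := (msupp x `|` msupp y)%fset.
have E z : (msupp z `<=` D)%fset ->
    malg_lift z = \sum_(k <- D) g k.1 k.2 *~ z@_k.
  move=> sD; apply: big_fset_incl => // k _ /mcoeff_outdom ->.
  by rewrite mulr0z.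
rewrite !E ?fsubsetUl ?fsubsetUr ?msuppB_le // -sumrB.
by apply: eq_bigr => k _; rewrite mcoeffB mulrzBr.
Qed.

Lemma malg_liftU h v : malg_lift << (h, v) >> = g h v.
Proof. by rewrite /malg_lift msuppU oner_eq0 big_seq_fset1 mcoeffUU. Qed.

Lemma malg_lift_tensor z : z \in gensub (tensor_rel f (N:=N)) -> malg_lift z = 0.
Proof.
move=> Iz; apply/eqP; apply: (gensub_min (P := [pred z | malg_lift z == 0])) Iz.
  split; first by rewrite inE -[0 in X in X == _]subr0 malg_liftB subrr.
  by move=> x y; rewrite !inE malg_liftB => /eqP -> /eqP ->; rewrite subrr.
move=> s [h h' v|h v v'|h a v]; rewrite inE !malg_liftB !malg_liftU.
- by rewrite gDl addrAC addrK subrr.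
- by rewrite gDr addrAC addrK subrr.
- by rewrite g_bal subrr.
Qed.

(** Universal property of the tensor product: the linear extension of a balanced biadditive map
    vanishes on [tensor_rel], hence factors through the quotient. *)
Lemma tensor_lift : exists psi : tensor f N -> V, {morph psi : u v / u - v} /\
  forall h v, psi (\pi << (h, v) >>) = g h v.
Proof.
pose psi (m : tensor f N) := malg_lift (repr m).
have psiE z : psi (\pi z) = malg_lift z.
  apply/eqP; rewrite -subr_eq0 -malg_liftB; apply/eqP/malg_lift_tensor.
  by rewrite idealrBE reprK.
exists psi; split=> [|h v]; last by rewrite psiE malg_liftU.
elim/quotW=> x; elim/quotW=> y; rewrite !psiE -malg_liftB -psiE.
by congr psi; rewrite !piE.
Qed.

End TensorLift.

Section TensorElements.
Variables (A H : pzRingType) (f : {rmorphism A -> H}) (N : lmodType A).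

Definition pure_tensor (h : H) (v : N) : tensor f N := \pi << (h, v) >>.

Lemma pure_tensorZ g h v : g *: pure_tensor h v = pure_tensor (g * h) v.
Proof.
rewrite /pure_tensor; have := pi_scale_tensor f g << (h, v) >>.
by rewrite tensor_actU => E; apply: (esym E).
Qed.

Lemma pure_tensor_bal h a v : pure_tensor (h * f a) v = pure_tensor h (a *: v).
Proof. by apply/eqP; rewrite -idealrBE; apply/gensub_gen/tensor_bal. Qed.

Lemma tensor_generated (v0 : N) (m : tensor f N) :
  (forall v, exists a, v = a *: v0) -> exists h, m = h *: pure_tensor 1 v0.
Proof.
move=> N_gen; elim/quotW: m => z; elim/tensor_ind: z => [|z y [h zh] [g yg]|[h v]].
- by exists 0; rewrite scale0r !piE.
- by exists (h - g); rewrite scalerBl -zh -yg !piE.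
- have [a ->] := N_gen v; exists (h * f a).
  by rewrite pure_tensorZ mulr1 pure_tensor_bal.
Qed.

End TensorElements.

Lemma hxVx (C : fieldType) n (q : C) (j : 'I_n) : hxV q j * hx q j = 1.
Proof. by apply: affhecke_relE; constructor. Qed.

Section InducedModule.
Variables (C : fieldType) (n : nat) (q : C).
Local Notation H := (affhecke n q).
Local Notation L := (laurent n q).
Variables (t : 'I_n -> C) (N : lmodType L) (v0 : N).
Hypothesis n_gt0 : (0 < n)%N.
Hypothesis t_neq0 : forall j, t j != 0.
Hypothesis N_line : is_weight_line t v0.

Let w0 : Ind N := pure_tensor (laurent_incl n q) 1 v0.

Lemma pure_tensor_weight j : hx q j *: w0 = ((t j)%:A : H) *: w0.
Proof.
have [_ _ xv] := N_line.
rewrite /w0 !pure_tensorZ !mulr1 -[hx q j]mul1r.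
rewrite (pure_tensor_bal (laurent_incl n q) 1 (lx q j)) xv -pure_tensor_bal.
by rewrite mul1r.
Qed.

Lemma Ind_generated (m : Ind N) : exists h, m = h *: w0.
Proof.
by apply: tensor_generated => v; have [_ /(_ v)[c ->] _] := N_line; exists c%:A.
Qed.

Variables (d : nat) (phi : {lrmorphism H -> 'M[C]_d.+1}) (e : 'cV[C]_d.+1).
Hypothesis phi_e : forall j, phi (hx q j) *m e = t j *: e.

Lemma phi_hxV j : phi (hxV q j) *m e = (t j)^-1 *: e.
Proof.
have Ee : phi (hxV q j) *m (phi (hx q j) *m e) = e.
  by rewrite mulmxA -[_ *m phi _](rmorphM phi) hxVx rmorph1 mul1mx.
by rewrite phi_e -scalemxAr in Ee; rewrite -[in RHS]Ee scalerA mulVf // scale1r.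
Qed.

Lemma laurent_scalerC (a : L) c (v : N) :
  a *: ((c%:A : L) *: v) = (c%:A : L) *: (a *: v).
Proof.
rewrite !scalerA; congr (_ *: _).
by apply/val_inj; rewrite /= mulr_algl mulr_algr.
Qed.

Lemma laurent_scalerA c c' (v : N) :
  (c%:A : L) *: ((c'%:A : L) *: v) = ((c * c')%:A : L) *: v.
Proof. by rewrite scalerA mulr_algl scalerA. Qed.

Lemma line_inj (a b : C) : (a%:A : L) *: v0 = (b%:A : L) *: v0 -> a = b.
Proof.
have [v0n _ _] := N_line; move=> E; apply/eqP; rewrite -subr_eq0.
apply: contraNT v0n => abn; apply/eqP.
have {}E : ((a - b)%:A : L) *: v0 = 0 by rewrite scalerBl scalerBl E subrr.
have : (((a - b)^-1)%:A : L) *: (((a - b)%:A : L) *: v0) = v0.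
  by rewrite laurent_scalerA mulVf // !scale1r.
by rewrite E scaler0 => <-.
Qed.

(** C[X] acts on [e] and on [v0] through the same character: the elements acting by a common scalar
    form a subalgebra that contains the generators and their inverses. The predicate [S] lives on
    [H] and carries the membership proof, because [laurent_pred] is tested against subalgebras of
    [H]. *)
Lemma laurent_eigen (a : L) : exists2 c : C,
  phi (laurent_val a) *m e = c *: e & a *: v0 = (c%:A : L) *: v0.
Proof.
pose S : {pred H} := fun h => `[< exists hL : h \in @laurent_pred C n q,
  exists2 c : C, phi h *m e = c *: e & Laurent hL *: v0 = (c%:A : L) *: v0 >].
have [_ _ xv] := N_line.
suff /asboolP[aL [c ac av]] : laurent_val a \in S.
  by exists c => //; rewrite -av; congr (_ *: _); apply/val_inj.
have := laurent_valP a; move: (laurent_val a) => h /asboolP; apply.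
- split.
  + apply/asboolP; exists (rpred1 (@laurent_pred C n q)), 1.
      by rewrite rmorph1 mul1mx scale1r.
    by congr (_ *: _); apply/val_inj; rewrite /= scale1r.
  + move=> b u w /asboolP[uL [c ce cv]] /asboolP[wL [c' ce' cv']].
    have hL : b *: u + w \in @laurent_pred C n q by rewrite rpredD ?rpredZ.
    apply/asboolP; exists hL, (b * c + c').
      by rewrite linearP mulmxDl -scalemxAl ce ce' scalerA scalerDl.
    have -> : Laurent hL = (b%:A : L) * Laurent uL + Laurent wL.
      by apply/val_inj; rewrite /= mulr_algl.
    rewrite scalerDl cv' -(scalerA (b%:A : L)) cv laurent_scalerA -scalerDl.
    by rewrite -scalerDl.
  + move=> u w /asboolP[uL [c ce cv]] /asboolP[wL [c' ce' cv']].
    have hL : u * w \in @laurent_pred C n q by rewrite rpredM.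
    apply/asboolP; exists hL, (c * c').
      by rewrite rmorphM -mulmxA ce' -scalemxAr ce scalerA mulrC.
    have -> : Laurent hL = Laurent uL * Laurent wL by apply/val_inj.
    rewrite -(scalerA (Laurent uL)) cv' laurent_scalerC cv laurent_scalerA.
    by rewrite mulrC.
- move=> j; apply/asboolP; exists (hx_laurent q j), (t j) => //.
  exact: xv.
- move=> j.
  have hL : hxV q j \in @laurent_pred C n q by apply/asboolP => ? _ _; apply.
  apply/asboolP; exists hL, (t j)^-1; first exact: phi_hxV.
  have E : Laurent hL * lx q j = 1.
    by apply/val_inj; apply: hxVx.
  have Ev : v0 = Laurent hL *: (lx q j *: v0) by rewrite scalerA E scale1r.
  by rewrite [in RHS]Ev xv laurent_scalerC laurent_scalerA mulVf // !scale1r.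
Qed.

(** Frobenius reciprocity: sending [v0] to [e] is C[X]-linear by [laurent_eigen], so it extends to
    the induced module. The function [chi] reads the coordinate of a vector of the line on [v0]. *)
Lemma Ind_map_exists : exists psi : Ind N -> 'cV[C]_d.+1,
  {morph psi : u v / u - v} /\ forall h, psi (h *: w0) = phi h *m e.
Proof.
have [_ lineN _] := N_line.
have [chi chiE] := choice lineN.
have chiZ a v : chi v = a <-> v = (a%:A : L) *: v0.
  by split=> [<- //|E]; apply: line_inj; rewrite -chiE.
pose g (h : H) (v : N) : 'cV[C]_d.+1 := chi v *: (phi h *m e).
have gDl h h' v : g (h + h') v = g h v + g h' v.
  by rewrite /g rmorphD mulmxDl scalerDr.
have gDr h v v' : g h (v + v') = g h v + g h v'.
  have -> : g h (v + v') = (chi v + chi v') *: (phi h *m e).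
    by congr (_ *: _); apply/chiZ; rewrite !scalerDl -!chiE.
  by rewrite scalerDl.
have g_bal h (a : L) v : g (h * laurent_val a) v = g h (a *: v).
  have [c ce cv] := laurent_eigen a.
  have Echi : chi (a *: v) = chi v * c.
    by apply/chiZ; rewrite [in LHS](chiE v) laurent_scalerC cv laurent_scalerA.
  by rewrite /g rmorphM -mulmxA ce -scalemxAr scalerA Echi.
have [psi [psiB psiE]] := tensor_lift (f := laurent_incl n q) gDl gDr g_bal.
exists psi; split=> // h.
have -> : h *: w0 = pure_tensor (laurent_incl n q) h v0.
  by rewrite /w0 pure_tensorZ mulr1.
rewrite psiE /g; have -> : chi v0 = 1 by apply/chiZ; rewrite !scale1r.
by rewrite scale1r.
Qed.

End InducedModule.

Section CyclicIsomorphism.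
Variables (C : fieldType) (H : algType C) (V : fdmod H) (e : 'cV[C]_(fddim V)).
Variables (M : lmodType H) (w : M) (s : seq H) (psi : M -> 'cV[C]_(fddim V)).
Hypothesis e_gen : forall u, exists h, u = fdact V h *m e.
Hypothesis w_gen : forall m, exists h, m = h *: w.
Hypothesis size_s : size s = fddim V.
Hypothesis s_span : forall h, exists2 a, a \in lspan s & h *: w = a *: w.
Hypothesis psiB : {morph psi : x y / x - y}.
Hypothesis psi_act : forall h, psi (h *: w) = fdact V h *m e.

(* psi is onto from a space spanned by dim V vectors.                         *)
Lemma cyclic_map_inj : injective psi.
Proof.
pose A : 'M[C]_(fddim V) := \matrix_(r, k) (fdact V s`_k *m e) r 0.
have AE c : A *m c = fdact V (\sum_k c k 0 *: s`_k) *m e.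
  apply/matrixP => r l; rewrite ord1 mxE linear_sum mulmx_suml summxE.
  by apply: eq_bigr => k _; rewrite linearZ -scalemxAl !mxE mulrC.
have spanE a : a \in lspan s -> exists c : 'cV_(fddim V), a = \sum_k c k 0 *: s`_k.
  move=> /asboolP[c ->]; exists (\col_k c (cast_ord (esym size_s) k)).
  rewrite (reindex (cast_ord (esym size_s))) /=; last first.
    by exists (cast_ord size_s) => k _; rewrite ?cast_ordK ?cast_ordKV.
  by apply: eq_bigr => k _; rewrite mxE.
have surjA (u : 'cV_(fddim V)) : exists c : 'cV_(fddim V), u = A *m c.
  have [h ->] := e_gen u; have [a as_ ha] := s_span h.
  by have [c Ea] := spanE a as_; exists c; rewrite AE -Ea -!psi_act ha.
have [B AB] : exists B, A *m B = 1%:M.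
  have [c cE] := choice (fun k => surjA (col k 1%:M)).
  exists (\matrix_(k, l) c l k 0); apply/matrixP => k l.
  have := congr1 (fun v : 'cV_(fddim V) => v k 0) (cE l); rewrite !mxE => ->.
  by apply: eq_bigr => j _; rewrite !mxE.
suff ker m : psi m = 0 -> m = 0.
  by move=> x y E; apply/eqP; rewrite -subr_eq0; apply/eqP/ker; rewrite psiB E subrr.
have [h ->] := w_gen m; have [a as_ ->] := s_span h; have [c Ea] := spanE a as_.
rewrite psi_act Ea -AE => Ac0; suff -> : c = 0.
  by rewrite big1 ?scale0r // => k _; rewrite mxE scale0r.
by rewrite -[c]mul1mx -(mulmx1C AB) -mulmxA Ac0 mulmx0.
Qed.

Lemma cyclic_iso : fdmod_iso V M.
Proof.
have [h hE] := choice e_gen.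
have psiK u : psi (h u *: w) = u by rewrite psi_act -hE.
exists (fun u => h u *: w); split.
- by exists psi => // m; apply: cyclic_map_inj; rewrite psiK.
- move=> u v; apply: cyclic_map_inj; rewrite psiK -[h v *: w]opprK psiB -sub0r.
  have psi0 : psi 0 = 0 by rewrite -[0 in LHS]subr0 psiB subrr.
  by rewrite psiB psi0 !psiK sub0r opprK.
- move=> g u; apply: cyclic_map_inj.
  by rewrite psiK scalerA psi_act rmorphM /= -mulmxA -hE.
Qed.

End CyclicIsomorphism.

(** The two bounds meet here: [Ind N] is spanned by n! vectors and maps onto the cyclic module
    [phi], whose dimension is n!. *)
Lemma Ind_iso (C : fieldType) n (q : C) (t : 'I_n -> C) (N : lmodType (laurent n q))
    (v0 : N) d (phi : {lrmorphism affhecke n q -> 'M[C]_d.+1}) (e : 'cV[C]_d.+1) :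
    (0 < n)%N -> (forall j, t j != 0) -> is_weight_line t v0 -> d.+1 = n`! ->
    (forall j, phi (hx q j) *m e = t j *: e) ->
    (forall u, exists h, u = phi h *m e) ->
  fdmod_iso (FDMod phi) (Ind N).
Proof.
move=> n0 t0 Nv dn phie egen.
have [s [size_s s_span]] := weight_vector_span (@affhecke_relE C n q)
  (@affhecke_ind C n q) n0 (pure_tensor_weight Nv) t0.
have [psi [psiB psiE]] := Ind_map_exists t0 Nv phie.
apply: (@cyclic_iso _ _ (FDMod phi) e _ _ s psi egen (Ind_generated Nv)) => //.
by rewrite size_s -dn.
Qed.

(** * Filtrations of modules *)

Section GrothendieckClasses.
Variables (C : fieldType) (H : algType C).
Implicit Types V W : fdmod H.

Lemma fdclass_exact V' V V'' : short_exact V' V V'' ->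
  fdclass V = fdclass V' + fdclass V''.
Proof.
move=> ex; rewrite /fdclass -[RHS](raddfD (\pi_(groth H))).
apply/eqP; rewrite -idealrBE; apply: gensub_gen.
by exists V', V, V''; split=> //; rewrite opprD addrA.
Qed.

(** Three copies of a zero module form a short exact sequence, so the class is equal to its
    double. *)
Lemma fdclass_dim0 V : fddim V = 0%N -> fdclass V = 0.
Proof.
case: V => d phi /= d0; have Z (u : 'cV[C]_d) : u = 0.
  by apply/matrixP => r; have := ltn_ord r; rewrite [X in (_ < X)%N]d0.
suff /fdclass_exact : short_exact (FDMod phi) (FDMod phi) (FDMod phi).
  by move/eqP; rewrite eq_sym -subr_eq0 addrK => /eqP.
exists idfun, idfun; split=> //= w; first by exists w.
by split=> _; [exists w | apply: Z].
Qed.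

End GrothendieckClasses.

Section Subquotients.
Variables (C : fieldType) (H : algType C) (V : fdmod H).
Local Notation D := (fddim V).
Implicit Types P Q R : {set 'I_D}.

Definition sub_mx P Q (A : 'M[C]_D) : 'M[C]_(#|P|, #|Q|) :=
  mxsub enum_val enum_val A.

Lemma sub_mxM P Q R (A B : 'M[C]_D) :
  (forall r t s, r \in P -> t \notin Q -> s \in R -> A r t * B t s = 0) ->
  sub_mx P Q A *m sub_mx Q R B = sub_mx P R (A *m B).
Proof.
move=> AB0; apply/matrixP => r s; rewrite !mxE.
rewrite (bigID (mem Q)) /= [X in _ + X]big1 ?addr0; last first.
  by move=> t tQ; apply: AB0 => //; apply: enum_valP.
by rewrite [RHS]big_enum_val; apply: eq_bigr => t _; rewrite !mxE.
Qed.

Lemma sub_mx1 P : sub_mx P P 1%:M = 1%:M.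
Proof. by apply/matrixP => r s; rewrite !mxE (inj_eq enum_val_inj). Qed.

Lemma sub_mx_disjoint P Q : [disjoint P & Q] -> sub_mx P Q 1%:M = 0.
Proof.
move=> dPQ; apply/matrixP => r s; rewrite !mxE; case: eqP => // E.
by have := disjointFr dPQ (enum_valP r); rewrite E enum_valP.
Qed.

(** No product of two actions leaves [P] and comes back, so the principal blocks on [P] multiply
    like the full matrices: they define a subquotient of [V]. *)
Definition convex_set P := forall g h r t s, r \in P -> t \notin P -> s \in P ->
  fdact V g r t * fdact V h t s = 0.

Section Restriction.
Variables (P : {set 'I_D}) (cP : convex_set P).

Definition restr_act (h : H) : 'M[C]_#|P| := sub_mx P P (fdact V h).

Lemma restr_act_zmod : zmod_morphism restr_act.
Proof. by move=> g h; apply/matrixP => r s; rewrite !mxE rmorphB !mxE. Qed.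

Lemma restr_act_monoid : GRing.monoid_morphism restr_act.
Proof.
split=> [|g h]; first by rewrite /restr_act rmorph1 sub_mx1.
by rewrite /restr_act rmorphM /= -(@sub_mxM P P P) // => r t s; apply: cP.
Qed.

Lemma restr_act_scalable : scalable restr_act.
Proof. by move=> c h; apply/matrixP => r s; rewrite !mxE linearZ !mxE. Qed.

HB.instance Definition _ :=
  GRing.isZmodMorphism.Build H 'M[C]_#|P| restr_act restr_act_zmod.
HB.instance Definition _ :=
  GRing.isMonoidMorphism.Build H 'M[C]_#|P| restr_act restr_act_monoid.
HB.instance Definition _ :=
  GRing.isScalable.Build C H 'M[C]_#|P| *:%R restr_act restr_act_scalable.

Definition restr : fdmod H := FDMod (restr_act : {lrmorphism H -> 'M[C]_#|P|}).

End Restriction.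

(** The vanishing of the block with rows [P2] and columns [P1] makes the coordinate space of [P1] a
    submodule and that of [P2] the quotient. The maps are the coordinate inclusion [F] and
    projection [G]; [F'] and [G'] are linear splittings used to verify exactness. *)
Lemma restr_exact P1 P P2 (c1 : convex_set P1) (c : convex_set P)
    (c2 : convex_set P2) : P1 :|: P2 = P -> [disjoint P1 & P2] ->
    (forall h r s, r \in P2 -> s \in P1 -> fdact V h r s = 0) ->
  short_exact (restr c1) (restr c) (restr c2).
Proof.
move=> defP dP tri.
have in1 r : r \in P1 -> r \in P by rewrite -defP inE => ->.
have in2 r : r \in P2 -> r \in P by rewrite -defP inE orbC => ->.
have inP r : r \in P -> r \notin P1 -> r \in P2.
  by rewrite -defP inE => /orP[->|].
have inP' r : r \in P -> r \notin P2 -> r \in P1.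
  by rewrite -defP inE => /orP[|->].
have E0 Q r t : r \in Q -> t \notin Q -> (1%:M : 'M[C]_D) r t = 0.
  by move=> rQ tQ; rewrite mxE; case: eqP => // E; rewrite E (negbTE tQ) in rQ.
have E0' Q r t : r \in Q -> t \notin Q -> (1%:M : 'M[C]_D) t r = 0.
  by move=> rQ tQ; rewrite mxE eq_sym; case: eqP => // E; rewrite E (negbTE tQ) in rQ.
pose F := sub_mx P P1 1%:M; pose G := sub_mx P2 P 1%:M.
pose F' := sub_mx P1 P 1%:M; pose G' := sub_mx P P2 1%:M.
have F'F : F' *m F = 1%:M.
  by rewrite sub_mxM ?mulmx1 ?sub_mx1 // => r t s /in1 rP tP _; rewrite (E0 P) ?mul0r.
have GG' : G *m G' = 1%:M.
  by rewrite sub_mxM ?mulmx1 ?sub_mx1 // => r t s /in2 rP tP _; rewrite (E0 P) ?mul0r.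
have GF : G *m F = 0.
  rewrite sub_mxM ?mulmx1 ?sub_mx_disjoint //; first by rewrite disjoint_sym.
  by move=> r t s /in2 rP tP _; rewrite (E0 P) ?mul0r.
have FG : F *m F' + G' *m G = 1%:M.
  have sumE Q r s : (sub_mx P Q 1%:M *m sub_mx Q P 1%:M) r s =
      \sum_(t in Q) (1%:M : 'M[C]_D) (enum_val r) t * (1%:M : 'M[C]_D) t (enum_val s).
    by rewrite mxE [RHS]big_enum_val; apply: eq_bigr => t _; rewrite !mxE.
  apply/matrixP => r s; rewrite [LHS]mxE !sumE -[in RHS](mulmx1 1%:M) -{1}sub_mx1.
  rewrite -sub_mx1 sumE -bigU //=.
  by apply: eq_bigl => t; rewrite -defP !inE.
pose f := mulmx F : {linear 'cV_#|P1| -> 'cV_#|P|}.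
pose g := mulmx G : {linear 'cV_#|P| -> 'cV_#|P2|}.
exists f, g; split=> [h u|h u|u v E|w|u].
- rewrite /f /= !mulmxA; congr (_ *m _); rewrite /restr_act !sub_mxM ?mulmx1 ?mul1mx //.
    by move=> r t s rP tP sP1; rewrite (E0' P) ?mulr0 // in1.
  move=> r t s rP tP1 sP1; have [rt|rt] := eqVneq r t.
    by rewrite -rt (tri h r s) ?mulr0 // inP // rt.
  by rewrite mxE (negbTE rt) mul0r.
- rewrite /g /= !mulmxA; congr (_ *m _); rewrite /restr_act !sub_mxM ?mulmx1 ?mul1mx //.
    move=> r t s rP2 tP2 sP; have [ts|ts] := eqVneq t s.
      by rewrite ts (tri h r s) ?mul0r // inP' // -ts.
    by rewrite mxE (negbTE ts) mulr0.
  by move=> r t s rP tP sP1; rewrite (E0 P) ?mul0r // in2.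
- by rewrite -[u]mul1mx -[v]mul1mx -F'F -!mulmxA; congr (_ *m _).
- by exists (G' *m w); rewrite /g /= mulmxA GG' mul1mx.
- split=> [gu|[v <-]]; last by rewrite /f /g /= mulmxA GF mul0mx.
  exists (F' *m u); rewrite /f /= mulmxA.
  by rewrite -[RHS]mul1mx -FG mulmxDl -[G' *m G *m u]mulmxA [G *m u]gu mulmx0 addr0.
Qed.

(** Renumbering by [enum_val] is an isomorphism. It becomes an equality of classes through an exact
    sequence whose third term is the zero module [restr c0]. *)
Lemma fdclass_restrT (cT : convex_set setT) : fdclass V = fdclass (restr cT).
Proof.
have c0 : convex_set set0 by move=> g h r t s; rewrite inE.
have Z0 : fdclass (restr c0) = 0 by apply: fdclass_dim0; rewrite /= cards0.
have sumT (G : 'I_D -> C) : \sum_(k < #|[set: 'I_D]|) G (enum_val k) = \sum_t G t.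
  by rewrite -big_enum_val; apply: eq_bigl => t; rewrite inE.
have sum1 (G : 'I_D -> C) t : \sum_s (t == s)%:R * G s = G t.
  rewrite (bigD1 t) //= eqxx mul1r big1 ?addr0 // => s.
  by rewrite eq_sym => /negbTE ->; rewrite mul0r.
pose F : 'M[C]_(#|[set: 'I_D]|, D) := \matrix_(k, t) (enum_val k == t)%:R.
pose F' : 'M[C]_(D, #|[set: 'I_D]|) := \matrix_(t, k) (t == enum_val k)%:R.
have FM (A : 'M[C]_D) : F *m A = sub_mx setT setT A *m F.
  apply/matrixP => k s; rewrite !mxE.
  under eq_bigr do rewrite mxE; under [RHS]eq_bigr do rewrite !mxE mulrC eq_sym.
  by rewrite (sumT (fun t => (s == t)%:R * A (enum_val k) t)) !sum1.
have F'F : F' *m F = 1%:M.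
  apply/matrixP => t s; rewrite !mxE; under eq_bigr do rewrite !mxE.
  by rewrite (sumT (fun u => (t == u)%:R * (u == s)%:R)) sum1.
have FF' : F *m F' = 1%:M.
  apply/matrixP => k l; rewrite !mxE; under eq_bigr do rewrite !mxE.
  by rewrite sum1 (inj_eq enum_val_inj).
suff /fdclass_exact : short_exact V (restr cT) (restr c0) by rewrite Z0 addr0 => <-.
pose f := mulmx F : {linear 'cV_D -> 'cV_#|[set: 'I_D]|}.
pose g := mulmx 0 : {linear 'cV[C]_#|[set: 'I_D]| -> 'cV_#|(set0 : {set 'I_D})|}.
have no_row (u : 'cV[C]_#|(set0 : {set 'I_D})|) : u = 0.
  by apply/matrixP => r; have := ltn_ord r; rewrite [X in (_ < X)%N]cards0.
exists f, g; split=> [h u|h u|u v E|w|u].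
- by rewrite /f /= !mulmxA FM.
- by rewrite [LHS]no_row [RHS]no_row.
- by rewrite -[u]mul1mx -[v]mul1mx -F'F -!mulmxA; congr (_ *m _).
- by exists 0; rewrite [w]no_row raddf0.
- split=> _; last exact: no_row.
  by exists (F' *m u); rewrite /f /= mulmxA FF' mul1mx.
Qed.

End Subquotients.

Section LabelFiltration.
Variables (C : fieldType) (H : algType C) (V : fdmod H) (K : finType).
Variable lab : 'I_(fddim V) -> {set K}.
Hypothesis lab_sub : forall h r s, fdact V h r s != 0 -> lab s \subset lab r.
Implicit Types (U : {set {set K}}) (A B E : {set K}).

Definition convex_labels U := forall A B E,
  A \in U -> E \in U -> A \subset B -> B \subset E -> B \in U.

Definition with_label U : {set 'I_(fddim V)} := [set r | lab r \in U].

Lemma convex_with_label U : convex_labels U -> convex_set (with_label U).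
Proof.
move=> cU g h r t s; rewrite !inE => rU tU sU; apply/eqP; rewrite mulf_eq0.
apply/norP => -[/lab_sub tr /lab_sub st].
by move/negP: tU; apply; apply: cU sU rU st tr.
Qed.

Lemma convex_labels1 A : convex_labels [set A].
Proof.
move=> A' B E; rewrite !inE => /eqP -> /eqP -> AB BA.
by rewrite eqEsubset AB BA.
Qed.

Definition label_piece A : fdmod H := restr (convex_with_label (@convex_labels1 A)).

(* A minimal label A of U gives a quotient, the labels U :\ A a submodule.     *)
Lemma fdclass_convex_labels U (cU : convex_labels U) :
  fdclass (restr (convex_with_label cU)) = \sum_(A in U) fdclass (label_piece A).
Proof.
have [m] := ubnP #|U|; elim: m => // m IHm in U cU *; rewrite ltnS => leUm.
have [U0|[A0 A0U]] := set_0Vmem U.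
  rewrite [RHS]big1 => [|A]; last by rewrite U0 inE.
  apply: fdclass_dim0 => /=.
  by apply/eqP; rewrite cards_eq0 -subset0; apply/subsetP => r; rewrite !inE U0 inE.
pose A := [arg min_(A < A0 in U) #|A|].
have [AU minA] : A \in U /\ forall B, B \in U -> (#|A| <= #|B|)%N.
  by rewrite /A; case: arg_minnP.
have minA' B : B \in U -> B \subset A -> B = A.
  by move=> BU BA; apply/eqP; rewrite eqEcard BA minA.
have cU' : convex_labels (U :\ A).
  move=> X Y Z; rewrite !inE => /andP[XA XU] /andP[_ ZU] XY YZ.
  rewrite (cU X _ Z) // andbT; apply: contraNneq XA => YA.
  by rewrite (minA' X) // -YA.
rewrite (big_setD1 A) //= -(IHm _ cU'); last first.
  by rewrite (cardsD1 A) AU in leUm.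
rewrite addrC; apply: fdclass_exact; apply: restr_exact.
- apply/setP => r; rewrite !inE; case: eqP => [->|] //=.
  by rewrite orbF.
- rewrite -setI_eq0; apply/eqP/setP => r; rewrite !inE.
  by case: eqP => //= _; rewrite andbF.
- move=> h r s; rewrite !inE => /eqP rA /andP[sA sU]; apply/eqP.
  apply: contraR sA => /lab_sub; rewrite rA => sub.
  by rewrite (minA' (lab s)).
Qed.

Lemma fdclass_labels : fdclass V = \sum_A fdclass (label_piece A).
Proof.
have cT : convex_labels [set: {set K}] by move=> *; rewrite inE.
have eT : with_label [set: {set K}] = setT by apply/setP => r; rewrite !inE.
transitivity (fdclass (restr (convex_with_label cT))); last first.
  by rewrite fdclass_convex_labels; apply: eq_bigl => A; rewrite inE.
by move: (convex_with_label cT); rewrite eT => c; apply: fdclass_restrT.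
Qed.

End LabelFiltration.

(** * Descent filtration of the seminormal module *)

Section SeminormalModule.
Variables (C : fieldType) (n : nat) (q : C).
Hypothesis q_neq0 : q != 0.
Hypothesis q_not_root : forall m : nat, (0 < m)%N -> q ^+ m != 1.
Variables (d : nat) (ix : 'I_d.+1 -> {perm 'I_n}) (xi : {perm 'I_n} -> 'I_d.+1).
Hypothesis ixK : cancel ix xi.
Hypothesis xiK : cancel xi ix.
Implicit Types (i k : 'I_n.-1) (j : 'I_n) (s : {perm 'I_n}).
Variable phi : {lrmorphism affhecke n q -> 'M[C]_d.+1}.
Hypothesis phiT : forall i, phi (hT q i) = snT q ix i.
Hypothesis phix : forall j, phi (hx q j) = snX q ix j.
Hypothesis phixV : forall j, phi (hxV q j) = snXV q ix j.

(** As [s] sends an entry to the number of its box, k is a descent when box k+1 holds a smaller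
    entry than box k. In a tableau on a lattice path this is what a step up requires. *)
Definition descents s : {set 'I_n.-1} :=
  [set k | (s^-1 (hi k) < s^-1 (lo k))%N]%g.

Definition sn_basis s : 'cV[C]_d.+1 := delta_mx (xi s) 0.

Lemma sn_basisE s t : sn_basis s (xi t) 0 = (t == s)%:R.
Proof. by rewrite mxE eqxx andbT (can_eq xiK). Qed.

Lemma cV_ext (u v : 'cV[C]_d.+1) : (forall s, u (xi s) 0 = v (xi s) 0) -> u = v.
Proof. by move=> E; apply/matrixP => r c; rewrite ord1 -[r]ixK E. Qed.

Lemma snX_basis j s : snX q ix j *m sn_basis s = wt q s j *: sn_basis s.
Proof.
apply: cV_ext => t; rewrite snXE // [RHS]mxE sn_basisE.
by case: eqP => [->|]; rewrite ?mulr0.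
Qed.

Lemma snT_basis i s : snT q ix i *m sn_basis s =
  sn_diag q i s *: sn_basis s + sn_off q i s *: sn_basis (sw i s).
Proof.
apply: cV_ext => t; rewrite snTE // [RHS]mxE [X in _ = X + _]mxE [X in _ = _ + X]mxE !sn_basisE.
rewrite (inv_eq (swK i)); congr (_ + _); first by case: eqP => [->|]; rewrite ?mulr0.
by case: eqP => [->|]; rewrite ?mulr0 ?swK.
Qed.

Lemma val_simple i (x : 'I_n) : simple i x =
  (if x == i :> nat then i.+1 else if x == i.+1 :> nat then i : nat else x) :> nat.
Proof.
case: tpermP => [->|->|/eqP xl /eqP xh] /=.
- by rewrite eqxx.
- by rewrite eqxx gtn_eqF.
- by rewrite -!val_eqE /= in xl xh; rewrite (negbTE xl) (negbTE xh).
Qed.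

Lemma ltn_simple i (x y : 'I_n) : (x < y)%N -> ~~ ((x == lo i) && (y == hi i)) ->
  (simple i x < simple i y)%N.
Proof.
by rewrite -!val_eqE !val_simple /=; do !case: eqP => ?; lia.
Qed.

Lemma swV i s j : ((sw i s)^-1 j)%g = simple i (s^-1 j)%g.
Proof. by rewrite /sw invMg permM tpermV. Qed.

(** Over the common denominator, the numerator is proportional to the difference of q^2 times the
    weight at [hi i] and the weight at [lo i], and distinct powers of q differ. *)
Lemma sn_off_eq0 i s : (sn_off q i s == 0) = (s (lo i) == (s (hi i)).+1 :> nat).
Proof.
have wn : wt q s (hi i) - wt q s (lo i) != 0.
  by rewrite subr_eq0 (inj_eq (@wt_inj _ _ _ q_neq0 q_not_root s)) // eq_sym lo_neq_hi.
have -> : sn_off q i s = q^-1 * (q ^+ 2 * wt q s (hi i) - wt q s (lo i)) /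
    (wt q s (hi i) - wt q s (lo i)).
  by rewrite /sn_off /sn_diag; field; rewrite q_neq0 wn.
rewrite !mulf_eq0 !invr_eq0 (negbTE q_neq0) (negbTE wn) orbF /= subr_eq0.
rewrite /wt -exprD (inj_eq (expq_inj q_neq0 q_not_root)) eq_sym -mulnS.
by rewrite eqn_pmul2l.
Qed.

(** The property passes to sums and products, so only [T i] matters. An adjacent transposition
    reverses the order of no pair of positions other than [lo i], [hi i]; a descent could be lost
    only if these held k+1 and k, and then the coefficient is zero by [sn_off_eq0]. *)
Lemma sn_triangular h r t : phi h r t != 0 -> descents (ix t) \subset descents (ix r).
Proof.
pose S : {pred affhecke n q} := fun h =>
  [forall r, forall t, (phi h r t != 0) ==> (descents (ix t) \subset descents (ix r))].
suff /forallP/(_ r)/forallP/(_ t)/implyP : h \in S by [].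
have SP g : reflect (forall r t, phi g r t != 0 -> descents (ix t) \subset descents (ix r))
    (g \in S).
  apply: (iffP forallP) => [Sg r' t'|Sg r'].
    by move/forallP: (Sg r') => /(_ t')/implyP.
  by apply/forallP => t'; apply/implyP/Sg.
have diagS g (f : {perm 'I_n} -> C) :
    phi g = \matrix_(r, t) (f (ix r) *+ (r == t)) -> g \in S.
  move=> gE; apply/SP => r' t'; rewrite gE mxE.
  by have [->|] := eqVneq r' t'; rewrite // mulr0n eqxx.
apply: affhecke_ind => [|i|j|j].
- split.
  + apply/SP => r' t'; rewrite rmorph1 mxE.
    by have [->|_] := eqVneq r' t'; rewrite // eqxx.
  + move=> c u w /SP Su /SP Sw; apply/SP => r' t'; rewrite linearP !mxE.
    case: (eqVneq (phi u r' t') 0) => [->|/Su //]; rewrite mulr0 add0r; exact: Sw.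
  + move=> u w /SP Su /SP Sw; apply/SP => r' t'; rewrite rmorphM mxE => nz.
    have [l lE] : exists l, phi u r' l * phi w l t' != 0.
      apply/existsP; apply: contraR nz; rewrite negb_exists => /forallP E.
      by rewrite big1 // => l _; apply/eqP; rewrite -[_ == _]negbK E.
    move: lE; rewrite mulf_eq0 negb_or => /andP[/Su s1 /Sw s2].
    exact: subset_trans s2 s1.
- apply/SP => r' t'; rewrite phiT mxE.
  have [-> //|rt] := eqVneq r' t'; rewrite mulr0n add0r.
  have [tE|_] := eqVneq (ix t') _; last by rewrite eqxx.
  have {tE} rE : ix r' = sw i (ix t') by rewrite tE swK.
  rewrite rE mulr1n sn_off_eq0 => nz; move: (ix t') nz => s nz.
  apply/subsetP => k; rewrite !inE !swV => /ltn_simple; apply.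
  apply: contra nz => /andP[/eqP pl /eqP ph].
  by rewrite -pl -ph !permKV.
- exact: (diagS _ (fun s => wt q s j)).
- exact: (diagS _ (fun s => (wt q s j)^-1)).
Qed.

(** An increasing s gains at least one at each step; counting from the first position gives s(j) >=
    j, and counting up to the last gives s(j) <= j. *)
Lemma perm_ascending s : (forall i, (s (lo i) < s (hi i))%N) -> s = 1%g.
Proof.
move=> asc; have step m (j k : 'I_n) : k = (j + m)%N :> nat -> (s j + m <= s k)%N.
  elim: m k => [|m IHm] k kE.
    by rewrite addn0 in kE; rewrite addn0 (val_inj kE).
  have k1n : (j + m < n.-1)%N by have := ltn_ord k; lia.
  have := IHm (lo (Ordinal k1n)) erefl; have := asc (Ordinal k1n).
  have -> : hi (Ordinal k1n) = k by apply/val_inj; rewrite /= kE addnS.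
  by move=> l1 l2; lia.
apply/permP => j; rewrite perm1; apply/val_inj/eqP => /=.
have n_gt0 : (0 < n)%N by apply: leq_trans (ltn_ord j).
have lastn : (n.-1 < n)%N by rewrite prednK.
have := step j (Ordinal n_gt0) j erefl; have := step (n.-1 - j)%N j (Ordinal lastn).
have := ltn_ord j; have := ltn_ord (s (Ordinal lastn)) => /= l1 l2 l3 l4.
by have := l3 _; lia.
Qed.

(** Sorting adjacent positions leads from any [s] to the identity. Reading the steps backwards, each
    one goes from an increasing pair to a decreasing pair, where the coefficient of T_i is
    nonzero. *)
Lemma sn_cyclic (u : 'cV_d.+1) : exists h, u = phi h *m sn_basis 1%g.
Proof.
pose S := [pred u : 'cV[C]_d.+1 | `[< exists h, u = phi h *m sn_basis 1%g >]].
have S0 : 0 \in S by apply/asboolP; exists 0; rewrite rmorph0 mul0mx.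
have SZ c v w : v \in S -> w \in S -> c *: v + w \in S.
  move=> /asboolP[h ->] /asboolP[g ->]; apply/asboolP; exists (c *: h + g).
  by rewrite linearP mulmxDl -scalemxAl.
have ST i v : v \in S -> snT q ix i *m v \in S.
  move=> /asboolP[h ->]; apply/asboolP; exists (hT q i * h).
  by rewrite rmorphM /= phiT -mulmxA.
(* Sorting a decreasing adjacent pair raises this weight, which is bounded by n^3; this gives the
   induction measure. *)
pose weight s := (\sum_(j < n) j * s j)%N.
have weight_sw s i : (s (hi i) < s (lo i))%N -> (weight s < weight (sw i s))%N.
  move=> lt; have split2 (F : 'I_n -> nat) : (\sum_j F j =
      F (lo i) + (F (hi i) + \sum_(j | (j != lo i) && (j != hi i)) F j))%N.
    by rewrite (bigD1 (lo i)) // (bigD1 (hi i)) //= eq_sym lo_neq_hi.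
  rewrite /weight !split2 !swE simple_lo simple_hi.
  rewrite [X in (_ < _ + (_ + X))%N](eq_bigr (fun j : 'I_n => j * s j)%N); last first.
    by move=> j /andP[j1 j2]; rewrite swE /simple tpermD // eq_sym.
  have -> : lo i = i :> nat by []; have -> : hi i = i.+1 :> nat by [].
  rewrite !mulSn; move: lt; move: (nat_of_ord (s _)) (nat_of_ord (s _)) => x y lt.
  by move: (\sum_(_ | _) _)%N (nat_of_ord i) => R z; nia.
have weight_le s : (weight s <= n * (n * n))%N.
  rewrite -[X in (_ <= X * _)%N](card_ord n) -sum_nat_const leq_sum // => j _.
  by apply: leq_mul; apply/ltnW/ltn_ord.
have basisS s : sn_basis s \in S.
  have [m] := ubnP (n * (n * n) - weight s); elim: m => // m IHm in s *.
  rewrite ltnS => le_m.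
  have [/forallP asc|] := boolP [forall i, s (lo i) < s (hi i)]%N.
    rewrite (perm_ascending asc); apply/asboolP; exists 1.
    by rewrite rmorph1 mul1mx.
  rewrite negb_forall; case/existsP => i; rewrite -leqNgt leq_eqVlt.
  rewrite val_eqE (inj_eq perm_inj) eq_sym (negbTE (lo_neq_hi i)) /= => desc.
  have wlt := weight_sw s i desc.
  have Ssw : sn_basis (sw i s) \in S.
    by apply: IHm; have := weight_le (sw i s); lia.
  have := ST i _ Ssw; rewrite snT_basis swK => STb.
  have off0 : sn_off q i (sw i s) != 0.
    by rewrite sn_off_eq0 !swE simple_lo simple_hi; lia.
  (* The formula for T_i on the vector of [sw i s] is solved for the vector of [s]. *)
  have -> : sn_basis s = (sn_off q i (sw i s))^-1 *:
      (- sn_diag q i (sw i s) *: sn_basis (sw i s) +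
       (sn_diag q i (sw i s) *: sn_basis (sw i s) + sn_off q i (sw i s) *: sn_basis s)).
    by rewrite scaleNr addKr scalerA mulVf // scale1r.
  by rewrite -[X in X \in S]addr0; apply: (SZ _ _ _ _ S0); apply: (SZ _ _ _ _ STb).
apply/asboolP; rewrite -/(u \in S).
have -> : u = \sum_s u (xi s) 0 *: sn_basis s.
  apply: cV_ext => t; rewrite summxE (bigD1 t) //= mxE sn_basisE eqxx mulr1.
  rewrite big1 ?addr0 // => s st; rewrite mxE sn_basisE eq_sym (negbTE st).
  by rewrite mulr0.
apply: (big_ind (fun v => v \in S)) => // [v w Sv Sw|s _].
  by rewrite -[v]scale1r; apply: SZ.
by rewrite -[_ *: _]addr0; apply: SZ.
Qed.

Definition sn_module : fdmod (affhecke n q) := FDMod phi.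
Definition sn_label (r : 'I_(fddim sn_module)) : {set 'I_n.-1} := descents (ix r).

Lemma sn_label_sub h r t : fdact sn_module h r t != 0 -> sn_label t \subset sn_label r.
Proof. exact: sn_triangular. Qed.

Definition sn_piece (A : {set 'I_n.-1}) : fdmod (affhecke n q) :=
  label_piece sn_label_sub A.

Section Tableaux.
Variables (A : {set 'I_n.-1}) (B : {set 'I_n * 'I_n}) (box : 'I_n -> 'I_n * 'I_n).
Hypothesis box_inj : injective box.
Hypothesis content_box : forall j, ribbon_content B (box j) = (j : nat)%:Z.
Hypothesis standardP : forall L : filling n, L \in standard_tableaux B <->
  exists2 s, descents s = A & L = [ffun j => box (s j)].
Local Notation P := (with_label sn_label [set A]).

Definition restrict_col (u : 'cV[C]_d.+1) : 'cV[C]_#|P| := \col_k u (enum_val k) 0.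

Lemma restrict_colD u v : restrict_col (u + v) = restrict_col u + restrict_col v.
Proof. by apply/matrixP => k l; rewrite !mxE. Qed.

Lemma restrict_colZ c u : restrict_col (c *: u) = c *: restrict_col u.
Proof. by apply/matrixP => k l; rewrite !mxE. Qed.

Lemma restrict_col0 s : descents s != A -> restrict_col (sn_basis s) = 0.
Proof.
move=> sA; apply/matrixP => k l; rewrite !mxE; case: eqP => //= kE.
by have := enum_valP k; rewrite kE !inE /sn_label xiK (negbTE sA).
Qed.

(** For a basis vector supported on the block, acting in the subquotient amounts to acting in V and
    forgetting the coordinates with other labels. *)
Lemma sn_piece_act h s : descents s = A ->
  fdact (sn_piece A) h *m restrict_col (sn_basis s) = restrict_col (phi h *m sn_basis s).
Proof.
move=> sA; apply/matrixP => k l; rewrite ord1 -colE !mxE.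
have sP : xi s \in P by rewrite !inE /sn_label xiK sA.
rewrite (bigD1 (enum_rank_in sP (xi s))) //= !mxE enum_rankK_in // eqxx mulr1.
rewrite big1 ?addr0 // => r rs; rewrite !mxE andbT.
case: eqP => [E|]; last by rewrite mulr0.
by case/eqP: rs; rewrite -[LHS](enum_valK_in sP) E.
Qed.

(** Injectivity of [box] makes the chosen permutation unique. The value is 0 for a filling that does
    not come from a permutation and, by [restrict_col0], for one whose descent set is not [A]. *)
Definition tableau_vector (L : filling n) : 'cV[C]_#|P| :=
  if [pick s : {perm 'I_n} | L == [ffun j => box (s j)]] is Some s
  then restrict_col (sn_basis s) else 0.

Lemma tableau_vectorE s :
  tableau_vector [ffun j => box (s j)] = restrict_col (sn_basis s).
Proof.
rewrite /tableau_vector; case: pickP => [t /eqP/ffunP E|/(_ s)]; last by rewrite eqxx.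
by congr (restrict_col (sn_basis _)); apply/permP => j; apply: box_inj;
  have := E j; rewrite !ffunE.
Qed.

(** In block [A] the seminormal formulas are those of the tableau module: box [s j] has content
    [s j], and the term in [sw i s] survives the restriction exactly when the swapped filling is
    standard. *)
Lemma sn_piece_tableau : is_tableau_module (ribbon_content B) B (sn_piece A).
Proof.
exists tableau_vector; split.
(* The vectors span the block, and there are at most as many tableaux as coordinates. *)
- rewrite basisEdim; apply/andP; split; last first.
    rewrite size_map -cardE dimvf dim_matrix.
    have -> : standard_tableaux B = [set [ffun j => box (ix r j)] | r in P].
      apply/setP => L; apply/idP/imsetP => [/standardP[s sA ->]|[r]].
        exists (xi s); first by rewrite !inE /sn_label xiK sA.
        by apply/ffunP => j; rewrite !ffunE xiK.
      move=> rP ->; apply/standardP; exists (ix r) => //.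
      by move: rP; rewrite !inE => /eqP.
    apply: leq_trans (leq_imset_card _ _) _.
    by rewrite -[leqRHS]/(#|P| * 1)%N muln1.
  apply/subvP => u _; have -> : u = \sum_k u k 0 *: restrict_col (sn_basis (ix (enum_val k))).
    apply/matrixP => k l; rewrite ord1 summxE (bigD1 k) //= !mxE ixK !eqxx mulr1.
    rewrite big1 ?addr0 // => r rk; rewrite !mxE ixK (inj_eq enum_val_inj).
    by rewrite eq_sym (negbTE rk) mulr0.
  apply: memv_suml => k _; apply: memvZ; apply: memv_span.
  rewrite -tableau_vectorE; apply: map_f; rewrite mem_enum; apply/standardP.
  by exists (ix (enum_val k)) => //; have := enum_valP k; rewrite !inE => /eqP.
- move=> L LB; rewrite /tableau_vector; case: pickP => // s /eqP Ls.
  by apply: restrict_col0; apply: contraNneq LB => sA; apply/standardP; exists s.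
- move=> L j /standardP[s sA ->].
  rewrite tableau_vectorE sn_piece_act // phix snX_basis restrict_colZ ffunE content_box.
  by rewrite /wt -exprnP.
- move=> L i /standardP[s sA ->].
  have -> : swap i [ffun j => box (s j)] = [ffun j => box (sw i s j)].
    by apply/ffunP => j; rewrite !ffunE swE.
  rewrite !tableau_vectorE sn_piece_act // phiT snT_basis restrict_colD !restrict_colZ.
  suff -> : T_diag q (ribbon_content B) [ffun j => box (s j)] i = sn_diag q i s by [].
  rewrite /T_diag !ffunE !content_box /sn_diag.
  have wn : wt q s (hi i) - wt q s (lo i) != 0.
    by rewrite subr_eq0 (inj_eq (@wt_inj _ _ _ q_neq0 q_not_root s)) // eq_sym lo_neq_hi.
  have -> : q ^ (2 * ((s (lo i) : nat)%:Z - (s (hi i) : nat)%:Z)) =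
      wt q s (lo i) / wt q s (hi i).
    have e (m : nat) : 2 * m%:Z = (2 * m)%N%:Z by lia.
    by rewrite mulrBr !e expfzDr // -invr_expz -!exprnP.
  have h0 : wt q s (hi i) != 0 by apply: wt_neq0.
  have wn' : 1 - wt q s (lo i) / wt q s (hi i) != 0.
    have -> : 1 - wt q s (lo i) / wt q s (hi i) =
        (wt q s (hi i) - wt q s (lo i)) / wt q s (hi i) by field.
    by rewrite mulf_neq0 ?invr_eq0.
  by field; rewrite q_neq0 h0 wn.
Qed.

End Tableaux.

End SeminormalModule.

(** * Ribbons *)

Section RibbonPath.
Variables (N : nat) (a : nat -> bool).

(* Box k of the path; step j, from box j to box j + 1, goes up if a j and to  *)
(* the right otherwise. The last box, of index N, is in row 0.                *)
Definition path_row k := \sum_(k <= j < N) (a j : nat).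
Definition path_col k := \sum_(0 <= j < k) (~~ a j : nat).
Local Notation rw := path_row.
Local Notation cl := path_col.

Lemma path_rowS k : (k < N)%N -> rw k = (a k + rw k.+1)%N.
Proof. by move=> kN; rewrite /rw big_ltn. Qed.

Lemma path_colS k : cl k.+1 = (cl k + ~~ a k)%N.
Proof. by rewrite /cl big_nat_recr. Qed.

Lemma path_rowN : rw N = 0%N.
Proof. by rewrite /rw big_geq. Qed.

Lemma path_col0 : cl 0 = 0%N.
Proof. by rewrite /cl big_geq. Qed.

(** Either kind of step raises the diagonal index, column minus row, by one. The additive form
    avoids truncated subtraction. *)
Lemma path_diag k : (k <= N)%N -> (cl k + rw 0 = k + rw k)%N.
Proof.
elim: k => [|k IHk] kN; first by rewrite path_col0.
have := IHk (ltnW kN); rewrite (path_rowS kN) path_colS.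
by case: (a k) => /=; lia.
Qed.

Lemma path_row_mono k l : (k <= l)%N -> (l <= N)%N -> (rw l <= rw k)%N.
Proof.
move=> kl lN; rewrite -(subnKC kl) in lN *; move: (l - k)%N lN => m.
elim: m => [|m IHm] lN; first by rewrite addn0.
rewrite addnS in lN *; apply: leq_trans (IHm (ltnW lN)).
by rewrite (path_rowS lN) leq_addl.
Qed.

Lemma path_col_mono k l : (k <= l)%N -> (cl k <= cl l)%N.
Proof.
move=> kl; rewrite -(subnKC kl); elim: (l - k)%N => [|m IHm]; first by rewrite addn0.
by rewrite addnS path_colS; apply: leq_trans IHm _; apply: leq_addr.
Qed.

Definition horizontal (P : pred nat) := \sum_(0 <= j < N | P j) (~~ a j : nat).

Lemma horizontalS (P Q : pred nat) : (forall j, (j < N)%N -> P j -> Q j) ->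
  (horizontal P <= horizontal Q)%N.
Proof.
move=> PQ; rewrite /horizontal big_mkcond [leqRHS]big_mkcond /= !big_mkord.
apply: leq_sum => j _; case: ifP => // Pj; by rewrite PQ.
Qed.

Lemma path_colE k : (k <= N)%N -> cl k = horizontal (fun j => j < k)%N.
Proof. by move=> kN; rewrite /cl /horizontal (big_nat_widen _ _ _ _ _ kN). Qed.

(* A horizontal step j stays in the row of box j, so that row r starts after  *)
(* the horizontal steps made below it and extends by those made in it.        *)
Definition outer_row r := (if r <= rw 0 then (horizontal (fun j => r <= rw j)).+1 else 0)%N.
Definition inner_row r := horizontal (fun j => r < rw j)%N.

(** The diagonal of (r, s) singles out one candidate box k. Were it in another row, monotonicity of
    rows would compare [cl k], the number of horizontal steps before k, with the bounds on s and
    contradict [path_diag]. *)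
Lemma path_skew r s : (inner_row r <= s < outer_row r)%N <->
  exists2 k, (k <= N)%N & r = rw k /\ s = cl k.
Proof.
split=> [/andP[is_ so]|[k kN [-> ->]]]; last first.
  rewrite /outer_row path_row_mono // ltnS (path_colE kN) /inner_row.
  rewrite !horizontalS // => j jN /=; first by move=> jk; apply: path_row_mono => //; apply: ltnW.
  by apply: contraLR; rewrite -!leqNgt => kj; apply: path_row_mono => //; apply: ltnW.
move: so; rewrite /outer_row; case: ifP => // r0; rewrite ltnS => so.
have dN := path_diag (leqnn N); rewrite path_rowN in dN.
have s_le : (s <= cl N)%N.
  by apply: leq_trans so _; rewrite path_colE //; apply: horizontalS.
have kN : (s + rw 0 - r <= N)%N by lia.
(* By path_diag only the box with this index can be (r, s).                  *)
have [k kE] : exists k, k = (s + rw 0 - r)%N by exists (s + rw 0 - r)%N.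
rewrite -kE in kN; have dk := path_diag kN; exists k => //.
have [ltr|gtr|eqr] := ltngtP r (rw k); last by lia.
- suff : (cl k <= inner_row r)%N by lia.
  rewrite path_colE //; apply: horizontalS => j jN jk.
  by apply: leq_trans ltr _; apply: path_row_mono => //; apply: ltnW.
- suff : (horizontal (fun j => r <= rw j) <= cl k)%N by lia.
  rewrite path_colE //; apply: horizontalS => j jN rj.
  rewrite ltnNge; apply/negP => kj.
  by have := path_row_mono kj (ltnW jN); lia.
Qed.

Lemma outer_row_mono r r' : (r <= r')%N -> (outer_row r' <= outer_row r)%N.
Proof.
move=> rr; rewrite /outer_row; case: ifP => // r'0; rewrite (leq_trans rr r'0) ltnS.
by apply: horizontalS => j _; apply: leq_trans.
Qed.

Lemma inner_row_mono r r' : (r <= r')%N -> (inner_row r' <= inner_row r)%N.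
Proof. by move=> rr; apply: horizontalS => j _; apply: leq_ltn_trans. Qed.

Lemma inner_row_le_outer r : (inner_row r <= outer_row r)%N.
Proof.
rewrite /outer_row; case: ifP => r0.
  by apply: leqW; apply: horizontalS => j _; apply: ltnW.
rewrite leqn0 /inner_row /horizontal big_nat_cond big1 // => j /andP[/andP[_ jN] rj].
by have := path_row_mono (leq0n j) (ltnW jN); move: r0; lia.
Qed.

Lemma outer_row_gt r : (N < r)%N -> outer_row r = 0%N.
Proof.
have dN := path_diag (leqnn N); rewrite path_rowN in dN.
by move=> rN; rewrite /outer_row; case: ifP => //; lia.
Qed.

End RibbonPath.

Section Ribbon.
Variables (n : nat) (a : nat -> bool).
Local Notation N := n.-1.
Local Notation rw := (path_row N a).
Local Notation cl := (path_col a).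
Implicit Types (k l : 'I_n).

Lemma ord_le_pred k : (k <= N)%N.
Proof. by have := ltn_ord k; lia. Qed.

Lemma path_row_lt k : (rw k < n)%N.
Proof.
have := path_diag a (leqnn N); rewrite path_rowN.
by have := path_row_mono a (leq0n k) (ord_le_pred k); have := ltn_ord k; lia.
Qed.

Lemma path_col_lt k : (cl k < n)%N.
Proof.
have := path_diag a (leqnn N); rewrite path_rowN.
by have := path_col_mono a (ord_le_pred k); have := ltn_ord k; lia.
Qed.

Definition ribbon_box k : 'I_n * 'I_n := (Ordinal (path_row_lt k), Ordinal (path_col_lt k)).
Definition ribbon : {set 'I_n * 'I_n} := [set ribbon_box k | k : 'I_n].

Lemma diag_ribbon_box k : diag (ribbon_box k) = k%:Z - (rw 0)%:Z.
Proof. by rewrite /diag /=; have := path_diag a (ord_le_pred k); lia. Qed.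

Lemma ribbon_box_inj : injective ribbon_box.
Proof.
move=> k l /(congr1 (@diag n)); rewrite !diag_ribbon_box => E.
by apply/val_inj; move: E => /=; lia.
Qed.

Lemma mem_ribbon k : ribbon_box k \in ribbon.
Proof. exact: imset_f. Qed.

Lemma ribbonP b : reflect (exists k, b = ribbon_box k) (b \in ribbon).
Proof. by apply: (iffP imsetP) => [[k _ ->]|[k ->]]; exists k. Qed.

Lemma card_ribbon : #|ribbon| = n.
Proof. by rewrite card_imset ?card_ord //; apply: ribbon_box_inj. Qed.

(** Boxes of the path lie on consecutive diagonals, so those before box k are the boxes of smaller
    index; a tie on the diagonal forces equality. *)
Lemma content_ribbon_box k : ribbon_content ribbon (ribbon_box k) = k%:Z.
Proof.
rewrite /ribbon_content; congr Posz.
have -> : [set b' in ribbon | box_before b' (ribbon_box k)] =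
    [set ribbon_box l | l : 'I_n & (l < k)%N].
  apply/setP => b; rewrite !inE; apply/andP/imsetP => [[/ribbonP[l ->]]|[l]].
    rewrite /box_before !diag_ribbon_box => lk; exists l => //; rewrite inE.
    case/orP: lk => [|/andP[/eqP E /=]]; first by lia.
    by have -> : l = k by [apply/val_inj; move: E => /=; lia]; rewrite ltnn.
  rewrite inE => lk ->; rewrite mem_ribbon /box_before !diag_ribbon_box; split=> //.
  by apply/orP; left; lia.
rewrite card_imset; last exact: ribbon_box_inj.
have kn := ltnW (ltn_ord k).
transitivity #|[set widen_ord kn l | l : 'I_k]|; last first.
  by rewrite card_imset ?card_ord // => l l' /(congr1 val) /= /val_inj.
apply: eq_card => l; rewrite !inE; apply/idP/imsetP => [lk|[l' _ ->]]; last exact: (ltn_ord l').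
by exists (Ordinal lk) => //; apply/val_inj.
Qed.

Lemma nth_mkseq0 (f : nat -> nat) r : (forall r, (n <= r)%N -> f r = 0%N) ->
  nth 0 (mkseq f n) r = f r.
Proof.
move=> f0; have [rn|nr] := ltnP r n; first by rewrite nth_mkseq.
by rewrite nth_default ?size_mkseq // f0.
Qed.

Lemma partition_mkseq (f : nat -> nat) :
  (forall r r', (r <= r')%N -> (f r' <= f r)%N) -> is_partition (mkseq f n).
Proof.
move=> fm; apply/(sortedP 0) => i; rewrite size_mkseq => i_n.
by rewrite !nth_mkseq ?(ltnW i_n) //; apply: fm.
Qed.

Lemma ribbon_skew : (0 < n)%N -> Defs.is_skew ribbon.
Proof.
move=> n0; exists (mkseq (outer_row N a) n), (mkseq (inner_row N a) n).
have out0 r : (n <= r)%N -> outer_row N a r = 0%N.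
  by move=> nr; apply: outer_row_gt; lia.
have in0 r : (n <= r)%N -> inner_row N a r = 0%N.
  by move=> nr; apply/eqP; rewrite -leqn0 -(out0 r nr); apply: inner_row_le_outer.
split.
- by apply: partition_mkseq => r r'; apply: outer_row_mono.
- by apply: partition_mkseq => r r'; apply: inner_row_mono.
- by move=> r; rewrite !nth_mkseq0 //; apply: inner_row_le_outer.
move=> r s; rewrite !nth_mkseq0 // path_skew; split=> [[k kN [-> ->]]|[b /ribbonP[k ->] [-> ->]]].
  have kn : (k < n)%N by lia.
  by exists (ribbon_box (Ordinal kn)) => //; apply: mem_ribbon.
by exists k => //; apply: ord_le_pred.
Qed.

Lemma ribbon_box_step (i : 'I_n.-1) :
  if a i then (ribbon_box (lo i)).2 = (ribbon_box (hi i)).2 /\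
              (ribbon_box (lo i)).1 = (ribbon_box (hi i)).1.+1 :> nat
  else (ribbon_box (lo i)).1 = (ribbon_box (hi i)).1 /\
       (ribbon_box (hi i)).2 = (ribbon_box (lo i)).2.+1 :> nat.
Proof.
have rS := path_rowS a (ltn_ord i); have cS := path_colS a i.
by case: (a i) rS cS => /= rS cS; split; try apply: val_inj => /=; lia.
Qed.

Lemma adjacent_sym (b b' : 'I_n * 'I_n) : adjacent b b' = adjacent b' b.
Proof.
rewrite /adjacent (eq_sym b.1) (eq_sym b.2).
by rewrite (orbC (b.2.+1 == _)) (orbC (b.1.+1 == _)).
Qed.

Lemma ribbon_connected : is_connected ribbon.
Proof.
apply/forall_inP => _ /ribbonP[k ->]; apply/forall_inP => _ /ribbonP[l ->].
set e := [rel u v | _].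
have e_sym : connect_sym e.
  apply: sym_connect_sym => u v /=; rewrite adjacent_sym.
  by case: (u \in _); case: (v \in _).
have n0 : (0 < n)%N by apply: leq_ltn_trans (ltn_ord k).
suff from0 m : connect e (ribbon_box (Ordinal n0)) (ribbon_box m).
  by apply: connect_trans (from0 l); rewrite e_sym.
case: m => m; elim: m => [|m IHm] mn.
  by have -> : Ordinal n0 = Ordinal mn by apply/val_inj.
have mN : (m < n.-1)%N by lia.
apply: connect_trans (IHm (ltnW mn)) _; apply: connect1; rewrite /e /=.
have -> : Ordinal (ltnW mn) = lo (Ordinal mN) by apply/val_inj.
have -> : Ordinal mn = hi (Ordinal mN) by apply/val_inj.
rewrite !mem_ribbon /= /adjacent; have := ribbon_box_step (Ordinal mN).
by case: ifP => _ [e1 e2]; rewrite e1 eqxx e2 eqxx ?orbT.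
Qed.

Lemma ribbon_in : (0 < n)%N -> ribbon \in connected_ribbons n.
Proof.
move=> n0; rewrite inE; apply/and5P; split.
- by apply/asboolP; apply: ribbon_skew.
- apply/forall_inP => _ /ribbonP[k ->]; apply/forall_inP => _ /ribbonP[l ->].
  apply/implyP; rewrite !diag_ribbon_box => /eqP E; apply/eqP; congr ribbon_box.
  by apply/val_inj => /=; lia.
- exact: ribbon_connected.
- have Nn : (N < n)%N by rewrite prednK.
  apply/andP; split; apply/exists_inP.
    by exists (ribbon_box (Ordinal Nn)); rewrite ?mem_ribbon //= path_rowN.
  by exists (ribbon_box (Ordinal n0)); rewrite ?mem_ribbon //= path_col0.
- by rewrite card_ribbon.
Qed.

End Ribbon.

Lemma connect_crossing (T : finType) (e : rel T) (P : pred T) x y :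
  connect e x y -> P x -> ~~ P y -> exists u v, [/\ e u v, P u & ~~ P v].
Proof.
move=> /connectP[p]; elim: p x => [|z p IHp] x /=; first by move=> _ -> ->.
move=> /andP[xz zp] yE Px Py; have [Pz|nPz] := boolP (P z); first exact: IHp zp yE Pz Py.
by exists x, z.
Qed.

Lemma adjacent_succ n (b b' : 'I_n * 'I_n) : adjacent b b' -> diag b < diag b' ->
  diag b' = diag b + 1 /\
  ((b.1 = b'.1 /\ b'.2 = b.2.+1 :> nat) \/ (b.2 = b'.2 /\ b.1 = b'.1.+1 :> nat)).
Proof.
rewrite /diag; case/orP => /andP[/eqP eqc /orP[/eqP E|/eqP E]] lt.
- by split; [move: eqc => /(congr1 val) /=; lia | left; split=> //; lia].
- by move: eqc => /(congr1 val) /=; lia.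
- by move: eqc => /(congr1 val) /=; lia.
- by split; [move: eqc => /(congr1 val) /=; lia | right; split=> //; lia].
Qed.

(** * Connected ribbons as lattice paths *)

Section RibbonOfSet.
Variable n : nat.
Hypothesis n_gt0 : (0 < n)%N.
Implicit Types (A : {set 'I_n.-1}) (B : {set 'I_n * 'I_n}) (i : 'I_n.-1).

Definition vertical A (j : nat) : bool :=
  if insub j is Some i then i \in A else false.

Lemma verticalE A i : vertical A i = (i \in A).
Proof. by rewrite /vertical valK. Qed.

Definition set_ribbon A : {set 'I_n * 'I_n} := ribbon n (vertical A).

(** The content recovers the index of a box from the ribbon as a set, so equal ribbons have the same
    k-th box for every k, and consecutive boxes reveal the direction of each step. *)
Lemma set_ribbon_inj : injective set_ribbon.
Proof.
move=> A A' E; have boxE (k : 'I_n) : ribbon_box (vertical A) k = ribbon_box (vertical A') k.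
  have : ribbon_box (vertical A) k \in set_ribbon A' by rewrite -E; apply: mem_ribbon.
  case/ribbonP => l kl; have := content_ribbon_box (vertical A) k.
  rewrite -/(set_ribbon A) E kl content_ribbon_box => -[lk].
  by rewrite (val_inj lk).
apply/setP => i; rewrite -!verticalE.
have := ribbon_box_step (vertical A) i; have := ribbon_box_step (vertical A') i.
rewrite !boxE; case: (vertical A i); case: (vertical A' i) => // -[e1 e2] [e3 e4].
  by move: e4; rewrite e1; lia.
by move: e2; rewrite e3; lia.
Qed.

(* The number of boxes on lower diagonals numbers the boxes of B from 0 to    *)
(* n - 1. A path in B from a lower box to box k + 1 first leaves the lower    *)
(* diagonals from box k, which is therefore adjacent to box k + 1.            *)
Lemma connected_ribbonP B : B \in connected_ribbons n -> exists A, B = set_ribbon A.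
Proof.
rewrite inE => /and5P[_ rib con /andP[/exists_inP[br brB /eqP br0] /exists_inP[bc bcB /eqP bc0]]].
move=> /eqP cardB.
have diag_inj b b' : b \in B -> b' \in B -> diag b = diag b' -> b = b'.
  move=> bB b'B E; have /forall_inP/(_ _ b'B) := forall_inP rib _ bB.
  by rewrite E eqxx => /eqP.
pose D (b : 'I_n * 'I_n) := [set b' in B | diag b' < diag b].
have D_lt b : b \in B -> (#|D b| < n)%N.
  move=> bB; apply: (@leq_trans #|B|); last by rewrite cardB.
  apply: proper_card; apply/properP; split.
    by apply/subsetP => b'; rewrite inE => /andP[].
  by exists b => //; rewrite inE ltxx andbF.
have D_mono b b' : b \in B -> diag b < diag b' -> (#|D b| < #|D b'|)%N.
  move=> bB lt; apply: proper_card; apply/properP; split.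
    by apply/subsetP => u; rewrite !inE => /andP[-> ub]; apply: lt_trans ub lt.
  by exists b; rewrite !inE ?bB ?lt // ltxx andbF.
have D_inj b b' : b \in B -> b' \in B -> #|D b| = #|D b'| -> b = b'.
  move=> bB b'B E; apply: diag_inj => //.
  by have [/D_mono|/D_mono|//] := ltgtP (diag b) (diag b'); rewrite ?bB ?b'B E ltnn => /(_ isT).
have /choice[beta betaP] (k : 'I_n) : exists b, b \in B /\ #|D b| = k.
  pose f (b : 'I_n * 'I_n) : 'I_n := insubd (Ordinal n_gt0) #|D b|.
  have fE b : b \in B -> f b = #|D b| :> nat.
    by move=> bB; rewrite /f val_insubd D_lt.
  have fB : f @: B = setT.
    apply/eqP; rewrite eqEcard subsetT cardsT card_ord card_in_imset ?cardB ?leqnn //.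
    by move=> b b' bB b'B /(congr1 val) /=; rewrite !fE //; apply: D_inj.
  have : k \in f @: B by rewrite fB inE.
  by case/imsetP => b bB ->; exists b; rewrite fE.
have betaB k : beta k \in B by case: (betaP k).
have betaD k : #|D (beta k)| = k by case: (betaP k).
have beta_onto b : b \in B -> exists k, b = beta k.
  by move=> bB; exists (Ordinal (D_lt b bB)); apply: D_inj; rewrite ?betaD.
have step i : ((beta (lo i)).1 = (beta (hi i)).1 /\
      (beta (hi i)).2 = (beta (lo i)).2.+1 :> nat) \/
    ((beta (lo i)).2 = (beta (hi i)).2 /\ (beta (lo i)).1 = (beta (hi i)).1.+1 :> nat).
  pose b := beta (hi i).
  have [b0 b0D] : exists b0, b0 \in D b by apply/card_gt0P; rewrite betaD.
  have b0B : b0 \in B by move: b0D; rewrite inE => /andP[].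
  have bD : ~~ (b \in D b) by rewrite inE ltxx andbF.
  have cb := forall_inP (forall_inP con _ b0B) _ (betaB (hi i)).
  have [u [v [/and3P[uB vB uv] uD vD]]] 
    := connect_crossing (P := fun x => x \in D b) cb b0D bD.
  have ub : diag u < diag b by move: uD; rewrite /= inE uB.
  have bv : diag b <= diag v by move: vD; rewrite /= inE vB -leNgt.
  have [dv uvE] := adjacent_succ uv (lt_le_trans ub bv).
  have vb : v = b.
    apply: (diag_inj _ _ vB (betaB (hi i))); apply/le_anti.
    by rewrite dv lezD1 ub -dv bv.
  rewrite vb in dv uvE.
  suff -> : beta (lo i) = u by [].
  apply: D_inj => //; rewrite betaD; have := betaD (hi i); rewrite -/b.
  (* As [b] lies on the diagonal just after that of [u], the box [u] immediately precedes [b] in the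
     numbering. *)
  have -> : D b = u |: D u.
    apply/setP => x; rewrite !inE dv; apply/andP/orP => [[xB xu]|[/eqP ->|/andP[xB xu]]].
    - have [xu'|ux] := ltP (diag x) (diag u); first by right; rewrite xB.
      by left; apply/eqP/(diag_inj _ _ xB uB)/le_anti; rewrite ux -ltzD1 xu.
    - by rewrite uB ltzD1.
    - by rewrite xB; split=> //; rewrite ltzD1 ltW.
  by rewrite cardsU1 inE ltxx andbF /= => -[].
pose A := [set i | (beta (lo i)).1 != (beta (hi i)).1]; exists A.
(* Coordinates along the path relative to the first box, whose position is not yet known; the row
   identity is additive to stay within natural numbers. *)
have coord m (mn : (m < n)%N) :
    ((beta (Ordinal mn)).2 = (beta (Ordinal n_gt0)).2 + path_col (vertical A) m :> nat)%N /\
    ((beta (Ordinal mn)).1 + path_row n.-1 (vertical A) 0 =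
     (beta (Ordinal n_gt0)).1 + path_row n.-1 (vertical A) m)%N.
  elim: m mn => [|m IHm] mn.
    by rewrite path_col0 addn0 (_ : Ordinal mn = Ordinal n_gt0) //; apply/val_inj.
  have [IH2 IH1] := IHm (ltnW mn); have mN : (m < n.-1)%N by lia.
  have hiE : Ordinal mn = hi (Ordinal mN) by apply/val_inj.
  have loE : Ordinal (ltnW mn) = lo (Ordinal mN) by apply/val_inj.
  rewrite loE in IH1 IH2; rewrite hiE.
  have rS := path_rowS (vertical A) mN; have cS := path_colS (vertical A) m.
  have vE := verticalE A (Ordinal mN); rewrite inE /= in vE.
  rewrite vE in rS cS.
  case: (step (Ordinal mN)) => -[e1 e2].
    by rewrite e1 eqxx /= in rS cS; rewrite e1 in IH1; split; lia.
  have ne : (beta (lo (Ordinal mN))).1 != (beta (hi (Ordinal mN))).1.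
    by apply/eqP => E; move: e2; rewrite E; lia.
  by rewrite ne /= in rS cS; rewrite e1 in IH2; split; lia.
have [kr krE] := beta_onto br brB; have [kc kcE] := beta_onto bc bcB.
have ordE (k : 'I_n) : Ordinal (ltn_ord k) = k by apply/val_inj.
have [_ r1] := coord kr (ltn_ord kr); have [c1 _] := coord kc (ltn_ord kc).
have Nn : (n.-1 < n)%N by rewrite prednK.
have [_ rN] := coord n.-1 Nn; rewrite path_rowN in rN.
rewrite ordE -krE br0 in r1; rewrite ordE -kcE bc0 in c1.
(* The box [br] in row 0 bounds the first row by the number of vertical steps; the last box, whose
   row is nonnegative, gives the reverse bound. *)
have row0 : (beta (Ordinal n_gt0)).1 = path_row n.-1 (vertical A) 0 :> nat.
  apply/eqP; rewrite eqn_leq; apply/andP; split.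
    by rewrite add0n in r1; rewrite r1 leq_addr.
  by rewrite addn0 in rN; rewrite -rN leq_addl.
have col0 : (beta (Ordinal n_gt0)).2 = 0%N :> nat.
  by apply/eqP; move/eqP: c1; rewrite eq_sym addn_eq0 => /andP[].
have betaE k : beta k = ribbon_box (vertical A) k.
  have [c2 r2] := coord k (ltn_ord k); rewrite ordE col0 in c2; rewrite ordE row0 in r2.
  rewrite [LHS]surjective_pairing; congr pair; apply/val_inj => //=.
  by apply/eqP; rewrite -(eqn_add2r (path_row n.-1 (vertical A) 0)) r2 addnC.
apply/setP => b; apply/idP/ribbonP => [/beta_onto[k ->]|[k ->]]; last by rewrite -betaE.
by exists k.
Qed.

End RibbonOfSet.

(** * Standard tableaux of a ribbon as permutations with a prescribed descent set *)

Section StandardTableaux.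
Variables (n : nat) (A : {set 'I_n.-1}).
Local Notation a := (vertical A).
Local Notation box := (@ribbon_box n a).
Implicit Types s : {perm 'I_n}.

Lemma ordinal_chain (f : 'I_n -> nat) (k l : 'I_n) : (k < l)%N ->
    (forall i : 'I_n.-1, (k <= i)%N -> (i < l)%N -> (f (lo i) < f (hi i))%N) ->
  (f k < f l)%N.
Proof.
move=> kl step; have chain m (mn : (m < n)%N) : (k < m)%N -> (m <= l)%N ->
    (f k < f (Ordinal mn))%N.
  elim: m mn => [//|m IHm] mn km ml; have mN : (m < n.-1)%N by lia.
  have hiE : Ordinal mn = hi (Ordinal mN) by apply/val_inj.
  have loE : Ordinal (ltnW mn) = lo (Ordinal mN) by apply/val_inj.
  have := step (Ordinal mN) km ml; rewrite -hiE -loE => lt.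
  move: km; rewrite ltnS leq_eqVlt => /orP[/eqP kE|km].
    by have <- : Ordinal (ltnW mn) = k by apply/val_inj.
  by apply: ltn_trans lt; apply: IHm => //; apply: ltnW.
have := chain l (ltn_ord l) kl (leqnn l).
by have -> : Ordinal (ltn_ord l) = l by apply/val_inj.
Qed.

Lemma ordinal_chain_gt (f : 'I_n -> nat) (k l : 'I_n) : (k < l)%N ->
    (forall i : 'I_n.-1, (k <= i)%N -> (i < l)%N -> (f (hi i) < f (lo i))%N) ->
  (f l < f k)%N.
Proof.
(* Subtracting from the maximum turns the decreasing chain into an increasing one. *)
pose M := \max_i f i; have le i : (f i <= M)%N by apply: leq_bigmax.
move=> kl step; have lt : (M - f k < M - f l)%N.
  apply: (@ordinal_chain (fun i => M - f i)%N) => // i ki il.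
  by have := step i ki il; have := le (lo i); lia.
by have := le k; lia.
Qed.

(** The entry of box k is the inverse of [s] at k. Standardness applied to consecutive boxes gives
    the descent set; conversely, two boxes in one row are joined by horizontal steps only and two in
    one column by vertical steps only, so the comparisons chain. *)
Lemma standard_ribbonP (L : filling n) : L \in standard_tableaux (set_ribbon A) <->
  exists2 s, descents s = A & L = [ffun j => box (s j)].
Proof.
split=> [|[s sA ->]].
  rewrite inE => /and4P[/injectiveP L_inj /eqP LB /'forall_forallP rowL /'forall_forallP colL].
  have /choice[f fE] (j : 'I_n) : exists k, L j = box k.
    by apply/ribbonP; rewrite -/(set_ribbon A) -LB; apply: imset_f.
  have f_inj : injective f by move=> i j E; apply: L_inj; rewrite !fE E.
  pose s := perm f_inj; have LE : L = [ffun j => box (s j)].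
    by apply/ffunP => j; rewrite ffunE permE fE.
  have LV k : L ((s^-1)%g k) = box k by rewrite LE ffunE permKV.
  exists s => //; apply/setP => i; rewrite inE.
  have := ribbon_box_step a i; rewrite verticalE; case: (i \in A) => -[e1 e2].
    have := implyP (colL ((s^-1)%g (hi i)) ((s^-1)%g (lo i))); apply.
    by rewrite !LV e1 eqxx e2 ltnSn.
  apply/negbTE; rewrite -leqNgt; apply/ltnW.
  have := implyP (rowL ((s^-1)%g (lo i)) ((s^-1)%g (hi i))); apply.
  by rewrite !LV e1 eqxx e2 ltnSn.
have box_s_inj : injective [ffun j => box (s j)].
  by move=> i j; rewrite !ffunE => /ribbon_box_inj/perm_inj.
rewrite inE; apply/and4P; split.
- exact/injectiveP.
- apply/eqP/setP => b; apply/imsetP/ribbonP => [[j _ ->]|[k ->]].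
    by exists (s j); rewrite ffunE.
  by exists ((s^-1)%g k) => //; rewrite ffunE permKV.
- apply/'forall_forallP => i j; apply/implyP; rewrite !ffunE /= => /andP[/eqP/(congr1 val) /= r c].
  have kl : (s i < s j)%N.
    by rewrite ltnNge; apply: contraL c => lk; rewrite -leqNgt path_col_mono.
  rewrite -(permK s i) -(permK s j).
  apply: (@ordinal_chain (fun x => (s^-1)%g x : nat)) => // m km ml.
  have m1N : (m.+1 <= n.-1)%N by apply: ltn_ord.
  have r1 := path_row_mono a km (ltnW m1N).
  have r2 := path_row_mono a ml (ord_le_pred (s j)).
  have := path_rowS a (ltn_ord m); rewrite verticalE.
  (* A vertical step between the two boxes would put them in different rows. *)
  have [mA|] := boolP (m \in A); first by move: (path_row _ _ _) r r1 r2 => *; lia.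
  rewrite -sA inE -leqNgt leq_eqVlt => /orP[|//].
  by rewrite val_eqE (inj_eq perm_inj) (negbTE (lo_neq_hi m)).
- apply/'forall_forallP => i j; apply/implyP; rewrite !ffunE /= => /andP[/eqP/(congr1 val) /= c r].
  have lk : (s j < s i)%N.
    by rewrite ltnNge; apply: contraL r => kl; rewrite -leqNgt path_row_mono ?ord_le_pred.
  rewrite -(permK s i) -(permK s j).
  apply: (@ordinal_chain_gt (fun x => (s^-1)%g x : nat)) => // m lm mk.
  have c1 := path_col_mono a lm; have c2 := path_col_mono a mk.
  have := path_colS a m; rewrite verticalE.
  have [|mA] := boolP (m \in A); last by lia.
  by rewrite -{1}sA inE.
Qed.

End StandardTableaux.

Theorem corollary6p3 (R : realType) (n : nat) (q : R[i])
    (n_ge1 : (1 <= n)%N) (q_neq0 : q != 0)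
    (q_not_root : forall k : nat, (0 < k)%N -> q ^+ k != 1)
    (Cvt : lmodType (laurent n q)) (vt : Cvt)
    (Cvt_line : is_weight_line (fun j : 'I_n => q ^+ (2 * j)) vt) :
  exists (V : fdmod (affhecke n q))
         (W : {set 'I_n * 'I_n} -> fdmod (affhecke n q)),
    [/\ fdmod_iso V (Ind Cvt),
        forall B, B \in connected_ribbons n ->
          is_tableau_module (ribbon_content B) B (W B)
      & fdclass V = \sum_(B in connected_ribbons n) fdclass (W B)].
Proof.
(* The dimension n! is written as a successor, so that the square matrices form a visibly nonzero
   algebra. *)
pose d := #|{perm 'I_n}|.-1.
have dE : d.+1 = #|{perm 'I_n}| by rewrite prednK //; apply/card_gt0P; exists 1%g.
pose ix (r : 'I_d.+1) : {perm 'I_n} := enum_val (cast_ord dE r).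
pose xi (s : {perm 'I_n}) : 'I_d.+1 := cast_ord (esym dE) (enum_rank s).
have ixK : cancel ix xi by move=> r; rewrite /xi /ix enum_valK cast_ordK.
have xiK : cancel xi ix by move=> s; rewrite /xi /ix cast_ordKV enum_rankK.
have [phi [phiT phix phixV]] := affhecke_lift
  (seminormal_rel q_neq0 q_not_root ixK xiK).
pose piece A := sn_piece q_neq0 q_not_root phiT phix phixV A.
(* [B] is decoded into its set of vertical steps; the default [set0] serves the sets [B] that are
   not ribbons of a path. *)
pose W (B : {set 'I_n * 'I_n}) := piece (odflt set0 [pick A | set_ribbon A == B]).
have WE A : W (set_ribbon A) = piece A.
  rewrite /W; case: pickP => [A' /eqP/set_ribbon_inj-> //|/(_ A)].
  by rewrite eqxx.
exists (FDMod phi), W; split.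
- apply: (Ind_iso (e := sn_basis _ xi 1%g) n_ge1 _ Cvt_line).
  + by move=> j; rewrite expf_neq0.
  + by rewrite dE card_Sn.
  + by move=> j; rewrite phix snX_basis // /wt perm1.
  + exact: (sn_cyclic q_neq0 q_not_root ixK xiK phiT).
- move=> B /(connected_ribbonP n_ge1)[A ->]; rewrite WE.
  apply: (sn_piece_tableau q_neq0 q_not_root ixK xiK phiT phix phixV
    (box := @ribbon_box n (vertical A))).
  + exact: ribbon_box_inj.
  + exact: content_ribbon_box.
  + exact: standard_ribbonP.
rewrite (fdclass_labels (sn_label_sub q_neq0 q_not_root phiT phix phixV)).
have -> : connected_ribbons n = [set set_ribbon A | A : {set 'I_n.-1}].
  apply/setP => B; apply/idP/imsetP => [/(connected_ribbonP n_ge1)[A ->]|[A _ ->]].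
    by exists A.
  exact: ribbon_in.
rewrite big_imset /=; last by move=> A A' _ _; apply: set_ribbon_inj.
by apply: eq_big => [A|A _]; rewrite ?inE // WE.
Qed.
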